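(* Let $G$ be an lcscN $R$-module over a syndetic ring $(R,+,\cdot)$ and let $(X,\mathscr{X},\mu)$ be a nontrivial standard Borel $G$-space. Then there exists a $G$-invariant $\sigma$-subalgebra $\mathscr{X}_1$ of $\mathscr{X}$ with $\{\varnothing,X\}\neq\mathscr{X}_1$ ($\mu$-mod $0$) such that for any $A\in\mathscr{X}_1$ with $\mu(A)>0$, any $l\ge 2$, any $g_1,\dots,g_l\in G$, and any $\varepsilon>0$, the set $$N_{g_1,\dots,g_l}(A,\varepsilon)=\left\{t\in R\ \Big|\ \int_X g_1^t1_A\cdots g_l^t1_A\,d\mu>\mu(A)^l-\varepsilon\right\}$$ is of positive lower Banach density in $(R,+)$, i.e. $$\liminf_{n\to\infty}\frac{|F_n\cap N_{g_1,\dots,g_l}(A,\varepsilon)|}{|F_n|}>0$$ over every weak Følner sequence $\{F_n\}_{n\ge1}$ in $(R,+)$. Consequently $N_{g_1,\dots,g_l}(A,\varepsilon)$ is syndetic in $(R,+)$, i.e. there is a compact set $K\subseteq R$ with $K+N_{g_1,\dots,g_l}(A,\varepsilon)=R$.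
   Context: An lcscN $R$-module $G$ over a syndetic ring $(R,+,\cdot)$ means: $G$ and $(R,+)$ are both locally compact second countable Hausdorff commutative groups, $G$ is an $R$-module, and (i) the scalar multiplication $(t,g)\mapsto t\cdot g$ is continuous from $R\times G$ to $G$; (ii) $G$ is a Noetherian $R$-module: every increasing sequence $G_0\subseteq G_1\subseteq\cdots$ of $R$-submodules of $G$ is eventually constant; (iii) $R$ is syndetic: for every $t\ne0$ in $R$ there is a compact $K\subseteq R$ with $K+Rt=R$. A standard Borel $G$-space $(X,\mathscr{X},\mu)$ is a standard Borel probability space with a jointly measurable $G$-action $G\times X\to X$, $(g,x)\mapsto gx$, such that each $g\in G$ preserves $\mu$. It is nontrivial if $\mathscr X\ne\{\varnothing,X\}$ mod $\mu$. For $t\in R$, $g\in G$ write $g^t:=t\cdot g\in G$; for a function $f$ on $X$, $(gf)(x)=f(gx)$, so $g^tf(x)=f((t\cdot g)x)$. $1_A$ is the indicator function of $A$. $|\cdot|$ is a fixed Haar measure on $(R,+)$. A weak Følner sequence in $(R,+)$ is a sequence $\{F_n\}$ of compact subsets of $R$ of positive Haar measure such that $\lim_{n\to\infty}|(r+F_n)\vartriangle F_n|/|F_n|=0$ for every $r\in R$. *)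

(* Defs.v *)
From HB Require Import structures.
From mathcomp Require Import all_boot all_order all_algebra.
From mathcomp Require Import all_classical all_reals all_analysis.

Set Implicit Arguments.
Unset Strict Implicit.
Unset Printing Implicit Defensive.

Import Order.TTheory GRing.Theory Num.Theory.
Import numFieldNormedType.Exports.

Local Open Scope classical_set_scope.
Local Open Scope ring_scope.

(* Only the additive group of R is topological: joint continuity of the
   multiplication of R is not required. *)
#[short(type="addTopRingType")]
HB.structure Definition AddTopRing :=
  {R of TopologicalZmodule R & GRing.PzRing R}.

(* TopologicalLmodule only allows scalars in a numDomainType; a join of
   TopologicalZmodule and GRing.Lmodule over an arbitrary ring clashes with it
   in the hierarchy, whence this bundling and the carrier alias. Continuity of
   the scaling is part of [lcscN_module]. *)
Record addTopLmodType (R : pzRingType) := AddTopLmod {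
  addTopLmod_zmod : topologicalZmodType ;
  addTopLmod_mixin : GRing.Zmodule_isLmodule R addTopLmod_zmod }.

Definition addTopLmod_sort (R : pzRingType) (G : addTopLmodType R) : Type :=
  addTopLmod_zmod G.

Coercion addTopLmod_sort : addTopLmodType >-> Sortclass.

HB.instance Definition _ (R : pzRingType) (G : addTopLmodType R) :=
  TopologicalZmodule.copy (addTopLmod_sort G) (addTopLmod_zmod G).
HB.instance Definition _ (R : pzRingType) (G : addTopLmodType R) :=
  (addTopLmod_mixin G : GRing.Zmodule_isLmodule R (addTopLmod_sort G)).

(* g_sigma_algebraType (@open V) is a measurableType only for a pointed V, and
   topologicalZmodType does not inherit from pointedType. *)
Definition Borel (V : topologicalZmodType) : Type := V.

HB.instance Definition _ (V : topologicalZmodType) :=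
  Choice.copy (Borel V) V.
HB.instance Definition _ (V : topologicalZmodType) :=
  isPointed.Build (Borel V) (0 : V).
HB.instance Definition _ (V : topologicalZmodType) :=
  @isMeasurable.Build (sigma_display (@open V)) (Borel V) <<s @open V >>
    (@sigma_algebra0 _ setT (@open V))
    (@sigma_algebraC (Borel V) (@open V))
    (@sigma_algebra_bigcup _ setT (@open V)).

Definition lcsc_hausdorff (T : topologicalType) :=
  [/\ locally_compact [set: T], @second_countable T & hausdorff_space T].

Definition set_add (V : zmodType) (A B : set V) : set V :=
  [set a + b | a in A & b in B].

Definition syndetic_set (V : topologicalZmodType) (N : set V) :=
  exists2 K : set V, compact K & set_add K N = setT.

Definition syndetic_ring (R : addTopRingType) :=
  forall t : R, t != 0 -> syndetic_set [set r * t | r in [set: R]].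

Definition noetherian_module (R : pzRingType) (G : lmodType R) :=
  forall M : nat -> set G,
    (forall n, GRing.submod_closed [in M n]) ->
    (forall n, M n `<=` M n.+1) ->
    exists N, forall n, (N <= n)%N -> M n = M N.

Record lcscN_module (R : addTopRingType) (G : addTopLmodType R) : Prop := {
  lcscN_ring_lcsc : lcsc_hausdorff R ;
  lcscN_module_lcsc : lcsc_hausdorff G ;
  lcscN_scale_continuous : continuous (fun z : R * G => z.1 *: z.2) ;
  lcscN_noetherian : noetherian_module G ;
  lcscN_syndetic : syndetic_ring R }.

(* The sigma-algebra of X is the Borel sigma-algebra of a Polish topology; the
   topology is carried by P and transported along the bijection phi. *)
Definition standard_borel (real : realType) d (X : measurableType d) :=
  exists (P : completePseudoMetricType real) (phi : P -> X),
    [/\ hausdorff_space P,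
        exists2 D : set P, countable D & dense D,
        bijective phi &
        forall A : set X, measurable A <-> <<s @open P >> (phi @^-1` A)].

Record standard_borel_space (real : realType) (G : topologicalZmodType)
    d (X : measurableType d) (mu : probability X real)
    (act : G -> X -> X) : Prop := {
  sbs_standard_borel : standard_borel real X ;
  sbs_act0 : forall x, act 0 x = x ;
  sbs_actD : forall g h x, act (g + h) x = act g (act h x) ;
  sbs_measurable :
    measurable_fun setT (fun p : Borel G * X => act p.1 p.2) ;
  sbs_preserving :
    forall g A, measurable A -> mu (act g @^-1` A) = mu A }.

Section mod0.
Context (real : realType) d (X : measurableType d).
Variable mu : {measure set X -> \bar real}.

Definition subset_mod0 (S1 S2 : set (set X)) :=
  forall A, S1 A -> exists2 B, S2 B & mu (A `+` B) = 0%E.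

Definition eq_mod0 S1 S2 := subset_mod0 S1 S2 /\ subset_mod0 S2 S1.

Definition trivial_mod0 (S : set (set X)) := eq_mod0 S [set set0; setT].

End mod0.

Definition sub_sigma_algebra_of d (X : measurableType d)
    (S : set (set X)) :=
  sigma_algebra setT S /\ S `<=` measurable.

(* g ranges over a group, so this amounts to equality of S with its preimage
   under every g. *)
Definition invariant_sets (G X : Type) (act : G -> X -> X)
    (S : set (set X)) :=
  forall g A, S A -> S (act g @^-1` A).

(* Every Borel measure that is finite on compact sets is regular on an lcsc
   Hausdorff space, so regularity is not required. *)
Record is_haar (real : realType) (V : topologicalZmodType)
    (m : {measure set (Borel V) -> \bar real}) : Prop := {
  haar_invariant : forall (v : V) (A : set (Borel V)), measurable A ->
    m [set v + a | a in A] = m A ;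
  haar_compact : forall K : set V, compact K -> (m K < +oo)%E ;
  haar_open : forall U : set V, open U -> U !=set0 -> (0 < m U)%E }.

Section density.
Context (real : realType) (V : topologicalZmodType).
Variable m : {measure set (Borel V) -> \bar real}.

Definition weak_Folner (F : nat -> set V) :=
  [/\ forall n, compact (F n),
      forall n, (0 < m (F n))%E &
      forall r : V,
        (fine (m ([set (r + a : V) | a in F n] `+` F n)) / fine (m (F n)))
          @[n --> \oo] --> (0 : real)].

Definition positive_lower_Banach_density (N : set V) :=
  forall F : nat -> set V, weak_Folner F ->
    (0 < limn_einf
       (fun n => (fine (m (F n `&` N)) / fine (m (F n)))%:E))%E.

End density.

Definition translate (X Y : Type) (G : Type) (act : G -> X -> X)
    (g : G) (f : X -> Y) : X -> Y := fun x => f (act g x).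

Definition return_times (real : realType) (R : addTopRingType)
    (G : addTopLmodType R) d (X : measurableType d)
    (mu : probability X real) (act : G -> X -> X)
    (l : nat) (g : 'I_l -> G) (A : set X) (eps : real) : set R :=
  [set t : R |
    (mu A ^+ l - eps%:E <
     \int[mu]_x (\prod_(i < l)
       translate act (t *: g i) (\1_A : X -> real) x)%:E)%E].

(* Main.v *)
(* Proof idea. The ring R is treated as a discrete abelian group: if finitely
   many translates of a measurable set N cover R, then N is syndetic and has
   positive lower Banach density, so it suffices to find such a finite cover.

   Call f almost periodic under a submodule Gam of G if its Gam-orbit is
   totally bounded in L^2. By Noetherianity choose Gam maximal such that some
   set of measure in ]0, 1[ has an almost periodic indicator; X1 consists of
   all sets with almost periodic indicator. For g outside Gam and f almost
   periodic under Gam with zero mean, the correlations of f along t |-> t g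
   vanish in density: otherwise averages of the projections onto the orbit
   vectors, taken with nearly minimal Hilbert-Schmidt norm, converge and map f
   to a nonconstant function which is almost periodic under Gam + R g,
   contradicting maximality. Van der Corput's inequality upgrades this to
   multiple mixing along elements that are distinct modulo Gam.

   Given g_1, ..., g_l, write each g_i as a coset representative h plus
   gamma_i in Gam. For t in a set with finitely many translates covering R all
   t gamma_i almost fix A, and off a set of density zero the translates of A
   by the t h are almost independent. *)
Require Import Defs.
From HB Require Import structures.
From mathcomp Require Import all_boot all_order all_algebra.
From mathcomp Require Import all_classical all_reals all_analysis.
From mathcomp Require Import measurable_realfun.
From mathcomp Require Import ring lra.

Set Implicit Arguments.
Unset Strict Implicit.
Unset Printing Implicit Defensive.

Import Order.TTheory GRing.Theory Num.Theory.
Import numFieldNormedType.Exports.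

Local Open Scope classical_set_scope.
Local Open Scope ring_scope.

(** * Bounded measurable functions *)

Lemma discriminant_le (real : realFieldType) (a b c : real) :
  0 <= a -> 0 <= c -> (forall s, 0 <= a - s * b *+ 2 + s ^+ 2 * c) ->
  b ^+ 2 <= a * c.
Proof.
move=> a0; rewrite le_eqVlt => /orP[/eqP c0|c0] H.
  rewrite -c0 mulr0.
  have [->|b0] := eqVneq b 0; first by rewrite expr0n.
  (* For [c = 0] the quadratic is affine in [s], and this choice gives it the value [- a - 2]. *)
  have := H ((a + 1) / b); rewrite -c0 mulr0 addr0 divfK// => Ha.
  by exfalso; lra.
have := H (b / c).
have -> : a - b / c * b *+ 2 + (b / c) ^+ 2 * c = a - b ^+ 2 / c.
  by field; rewrite gt_eqF.
by rewrite subr_ge0 ler_pdivrMr.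
Qed.

Lemma norm_le_of_sqr (real : realDomainType) (a b : real) :
  0 <= b -> a ^+ 2 <= b ^+ 2 -> `|a| <= b.
Proof.
by move=> b0; rewrite -[leLHS]real_normK ?num_real// ler_sqr ?nnegrE.
Qed.

Section BoundedMeasurable.
Context {real : realType} {d : measure_display} (X : measurableType d).

(** Functions are used rather than classes modulo null sets, so identities and inequalities can be
    checked point by point; boundedness keeps all products integrable. *)
Definition bmf_pred : {pred X -> real} :=
  mem [set f : X -> real | measurable_fun setT f /\
                           exists C, forall x, `|f x| <= C].

Record bmf := Bmf { bmf_fun :> X -> real ; bmf_funP : bmf_fun \in bmf_pred }.

HB.instance Definition _ := [isSub for bmf_fun].
HB.instance Definition _ := [Choice of bmf by <:].

Lemma bmf_subring_closed : subring_closed bmf_pred.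
Proof.
split.
- rewrite inE; split; first exact: measurable_cst.
  by exists 1 => x; rewrite normr1.
- move=> f g; rewrite !inE => -[mf [C hC]] [mg [D hD]]; split.
    exact: measurable_funB.
  exists (C + D) => x; apply: le_trans (ler_normB _ _) _.
  exact: lerD.
- move=> f g; rewrite !inE => -[mf [C hC]] [mg [D hD]]; split.
    exact: measurable_funM.
  by exists (C * D) => x; rewrite normrM ler_pM.
Qed.

HB.instance Definition _ := GRing.isSubringClosed.Build _ bmf_pred
  bmf_subring_closed.
HB.instance Definition _ := [SubChoice_isSubComNzRing of bmf by <:].

Lemma bmf_scaler_closed : scaler_closed bmf_pred.
Proof.
move=> a f; rewrite !inE => -[mf [C hC]]; split.
  exact: measurable_funM.
by exists (`|a| * C) => x; rewrite normrM ler_wpM2l.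
Qed.

HB.instance Definition _ := GRing.isScaleClosed.Build _ _ bmf_pred
  bmf_scaler_closed.
HB.instance Definition _ := [SubZmodule_isSubLmodule of bmf by <:].

Implicit Types f g : bmf.

Lemma bmf_ext f g : f =1 g -> f = g.
Proof. by move=> fg; apply/val_inj/funext. Qed.

Lemma bmf_measurable f : measurable_fun setT f.
Proof. by case: f => f /=; rewrite inE => -[]. Qed.

Lemma bmf_bounded f : exists C, forall x, `|f x| <= C.
Proof. by case: f => f /=; rewrite inE => -[]. Qed.

Lemma bmfD f g x : (f + g) x = f x + g x. Proof. by []. Qed.
Lemma bmfN f x : (- f) x = - f x. Proof. by []. Qed.
Lemma bmfB f g x : (f - g) x = f x - g x. Proof. by []. Qed.
Lemma bmfM f g x : (f * g) x = f x * g x. Proof. by []. Qed.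
Lemma bmfZ a f x : (a *: f) x = a * f x. Proof. by []. Qed.
Lemma bmf1 x : (1 : bmf) x = 1. Proof. by []. Qed.
Lemma bmf_sum (I : Type) (r : seq I) (F : I -> bmf) x :
  (\sum_(i <- r) F i) x = \sum_(i <- r) F i x.
Proof. by elim/big_rec2: _ => // i y1 y2 _ <-. Qed.
Lemma bmf_prod (I : Type) (r : seq I) (F : I -> bmf) x :
  (\prod_(i <- r) F i) x = \prod_(i <- r) F i x.
Proof. by elim/big_rec2: _ => // i y1 y2 _ <-. Qed.
Lemma bmfX f n x : (f ^+ n) x = f x ^+ n.
Proof. by elim: n => [|n IH]; rewrite ?expr0// !exprS bmfM IH. Qed.

Lemma bmf_scaleAl a f g : a *: (f * g) = a *: f * g.
Proof. by apply: bmf_ext => x; rewrite !(bmfZ, bmfM) mulrA. Qed.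

Lemma bmf_scaleM a b f g : (a *: f) * (b *: g) = (a * b) *: (f * g).
Proof. by apply: bmf_ext => x; rewrite !(bmfZ, bmfM) mulrACA. Qed.

Variable mu : probability X real.

Lemma bmf_integrable f : mu.-integrable setT (EFin \o f).
Proof.
apply: measurable_bounded_integrable => //.
- by rewrite [ltLHS]probability_setT ltry.
- exact: bmf_measurable.
- have [C hC] := bmf_bounded f.
  by exists C; split; rewrite ?num_real// => M CM x _; apply: le_trans (hC x) (ltW CM).
Qed.

Definition mean f : real := \int[mu]_x f x.

Lemma mean_is_zmod_morphism : zmod_morphism mean.
Proof. by move=> f g; rewrite /mean -RintegralB//; exact: bmf_integrable. Qed.
Lemma mean_is_scalable : scalable_for *%R mean.
Proof. by move=> a f; rewrite /mean -RintegralZl//; exact: bmf_integrable. Qed.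
HB.instance Definition _ := GRing.isZmodMorphism.Build bmf real mean
  mean_is_zmod_morphism.
HB.instance Definition _ := GRing.isScalable.Build real bmf real *%R mean
  mean_is_scalable.

Lemma mean_ge0 f : (forall x, 0 <= f x) -> 0 <= mean f.
Proof. by move=> f0; apply: Rintegral_ge0. Qed.

Lemma mean_le f g : (forall x, f x <= g x) -> mean f <= mean g.
Proof. by move=> fg; apply: le_Rintegral => //; exact: bmf_integrable. Qed.

Lemma mean1 : mean 1 = 1.
Proof.
by rewrite /mean Rintegral_cst// [X in fine X]probability_setT mul1r.
Qed.

Lemma mean_cst (a : real) : mean (a *: (1 : bmf)) = a.
Proof. by rewrite linearZ /= mean1 mulr1. Qed.

Lemma mean_sqr_ge0 f : 0 <= mean (f ^+ 2).
Proof. by apply: mean_ge0 => x; rewrite bmfX sqr_ge0. Qed.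

(** Discriminant of the nonnegative quadratic [s |-> mean mu ((f - s *: g) ^+ 2)]. *)
Lemma mean_CS f g : mean (f * g) ^+ 2 <= mean (f ^+ 2) * mean (g ^+ 2).
Proof.
have H s : 0 <= mean (f ^+ 2) - s * mean (f * g) *+ 2 + s ^+ 2 * mean (g ^+ 2).
  have := mean_sqr_ge0 (f - s *: g).
  have -> : (f - s *: g) ^+ 2 = f ^+ 2 - (s *: (f * g)) *+ 2 + s ^+ 2 *: g ^+ 2.
    apply: bmf_ext => x; rewrite mulr2n !(bmfD,bmfN,bmfX,bmfZ,bmfM); ring.
  by rewrite linearD linearB linearMn !linearZ /=.
exact: discriminant_le (mean_sqr_ge0 f) (mean_sqr_ge0 g) H.
Qed.

End BoundedMeasurable.
Arguments bmf real {d} X.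

(** * Null functions and finite colourings of an abelian group *)

Section NullFunctions.
Context {real : realType} {V : zmodType}.
Implicit Types (phi psi : V -> real) (S : set V).

(* [phi] vanishes in density: over suitable finite sets the averages of [|phi|]
   are small uniformly in the translation. This needs no Folner sequence and no
   invariant mean. *)
Definition null phi := forall e, 0 < e ->
  exists2 k : seq V, k != [::] &
    forall t, \sum_(s <- k) `|phi (t + s)| <= e * (size k)%:R.

Lemma null_approx phi :
  (forall e, 0 < e -> exists2 psi, null psi &
     forall t, `|phi t| <= `|psi t| + e) -> null phi.
Proof.
move=> H e e0; have e2 : 0 < e / 2 by rewrite divr_gt0.
have [psi /(_ _ e2)[k k0 hk] le] := H _ e2.
exists k => // t; apply: le_trans (ler_sum _ (fun s _ => le (t + s))) _.
rewrite big_split /= [X in _ <= X * _](splitr e) mulrDl lerD//.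
by rewrite big_const_seq count_predT iter_addr_0 mulr_natr.
Qed.

Lemma null_le phi psi C : (forall t, `|phi t| <= C * `|psi t|) ->
  null psi -> null phi.
Proof.
move=> le hpsi e e0; have C0 : 0 < `|C| + 1 by rewrite ltr_wpDl.
have [k k0 hk] := hpsi _ (divr_gt0 e0 C0); exists k => // t.
apply: (@le_trans _ _ (\sum_(s <- k) (`|C| + 1) * `|psi (t + s)|)).
  apply: ler_sum => s _; apply: le_trans (le _) _.
  by rewrite ler_wpM2r// (le_trans (ler_norm C))// lerDl.
by rewrite -mulr_sumr mulrC -ler_pdivlMr// mulrAC.
Qed.

Lemma null0 : null (fun=> 0).
Proof.
move=> e e0; exists [:: 0] => // t.
by rewrite big_seq1 normr0 mulr1 ltW.
Qed.

(* Averaging over the sumset of two averaging sets does as well as either. *)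
Lemma null_add phi psi : null phi -> null psi -> null (fun t => phi t + psi t).
Proof.
move=> hphi hpsi e e0; have e2 : 0 < e / 2 by rewrite divr_gt0.
have [k k0 hk] := hphi _ e2; have [l l0 hl] := hpsi _ e2.
exists [seq a + b | a <- k, b <- l].
  by case: k k0 {hk} => // a k _; case: l l0 {hl}.
move=> t; rewrite size_allpairs natrM.
apply: (@le_trans _ _ (\sum_(s <- [seq a + b | a <- k, b <- l])
   (`|phi (t + s)| + `|psi (t + s)|))).
  by apply: ler_sum => s _; exact: ler_normD.
rewrite big_split /= [X in _ <= X * _](splitr e) mulrDl lerD//.
- rewrite big_allpairs_dep exchange_big /=.
  apply: (@le_trans _ _ (\sum_(b <- l) (e / 2 * (size k)%:R))).
    apply: ler_sum => b _; apply: le_trans (hk (t + b)).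
    by rewrite le_eqVlt; apply/orP; left; apply/eqP; apply: eq_bigr => a _;
      rewrite (addrC a) addrA.
  by rewrite big_const_seq count_predT iter_addr_0 -[_ *+ size l]mulr_natr mulrA.
- rewrite big_allpairs_dep /=.
  apply: (@le_trans _ _ (\sum_(a <- k) (e / 2 * (size l)%:R))).
    apply: ler_sum => a _; apply: le_trans (hl (t + a)).
    by rewrite le_eqVlt; apply/orP; left; apply/eqP; apply: eq_bigr => b _;
      rewrite addrA.
  rewrite big_const_seq count_predT iter_addr_0 -[_ *+ size k]mulr_natr.
  by rewrite mulrA (mulrAC _ (size k)%:R).
Qed.

Lemma null_sum (I : Type) (r : seq I) (F : I -> V -> real) :
  (forall i, null (F i)) -> null (fun t => \sum_(i <- r) F i t).
Proof.
move=> hF; elim: r => [|i r IH].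
  by under eq_fun do rewrite big_nil; exact: null0.
under eq_fun do rewrite big_cons; exact: null_add (hF i) IH.
Qed.

Lemma null_norm phi : null phi -> null (fun t => `|phi t|).
Proof. by move=> h; refine (@null_le _ phi 1 _ h) => t; rewrite normr_id mul1r. Qed.

(** The inequality [|a| <= e^-1 * a ^+ 2 + e] reduces this to [null_approx] and takes the place of
    Cauchy-Schwarz on the averages. *)
Lemma null_sqr phi : null (fun t => phi t ^+ 2) -> null phi.
Proof.
move=> h; apply: null_approx => e e0.
exists (fun t => e^-1 * phi t ^+ 2).
  by refine (@null_le _ _ `|e^-1| _ h) => t; rewrite normrM.
move=> t; rewrite normrM (ger0_norm (sqr_ge0 _)) gtr0_norm ?invr_gt0//.
rewrite -(@ler_pM2l _ e)// mulrDr mulrA divff ?gt_eqF// mul1r -[phi t ^+ 2]real_normK ?num_real//.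
move: `|phi t| => a; rewrite -subr_ge0.
have -> : a ^+ 2 + e * e - e * a = (a - e / 2) ^+ 2 + 3 / 4 * e ^+ 2 by field.
by rewrite addr_ge0 ?sqr_ge0// mulr_ge0 ?sqr_ge0.
Qed.

(** This is syndeticity for the discrete topology. *)
Definition finite_cover S :=
  exists ks : seq V, forall t, exists2 k, k \in ks & S (t + k).

Lemma finite_cover_sub S S' : S `<=` S' -> finite_cover S -> finite_cover S'.
Proof.
move=> sub [ks hks]; exists ks => t.
by have [k kin /sub] := hks t; exists k.
Qed.

(** The sum of [|phi (t + k)|] over [k] in [ks] is again null, so a fixed finite list contains, for
    every [t], a shift [a] making the whole sum at [t + a] smaller than [e]. Whichever [k] then
    brings [t + a] into [S], [phi] is small there. *)
Lemma finite_cover_null S phi e : 0 < e -> finite_cover S -> null phi ->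
  finite_cover [set t | S t /\ `|phi t| < e].
Proof.
move=> e0 [ks hks] hphi.
have : null (fun t => \sum_(k <- ks) `|phi (t + k)|).
  apply: null_sum => k e' e'0; have [l l0 hl] := hphi _ e'0.
  exists l => // t; apply: le_trans (hl (t + k)).
  rewrite le_eqVlt; apply/orP; left; apply/eqP; apply: eq_bigr => s _.
  by rewrite normr_id addrAC.
have e2 : 0 < e / 2 by rewrite divr_gt0.
move=> /(_ _ e2)[l l0 hl].
exists [seq a + k | a <- l, k <- ks] => t.
have [a al ha] : exists2 a, a \in l & \sum_(k <- ks) `|phi (t + a + k)| < e.
  apply: contrapT => /forall2NP hn; have := hl t.
  rewrite leNgt => /negP; apply.
  apply: (@lt_le_trans _ _ (e * (size l)%:R)).
    rewrite ltr_pM2r; last by rewrite ltr0n; case: (l) l0.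
    by rewrite ltr_pdivrMr// ltr_pMr// ltr1n.
  rewrite mulr_natr -iter_addr_0 -count_predT -big_const_seq.
  rewrite big_seq [X in _ <= X]big_seq; apply: ler_sum => a al.
  have [//|] := hn a => /negP; rewrite -leNgt => h.
  exact: le_trans h (ler_norm _).
have [k kin hk] := hks (t + a).
exists (a + k); first by apply/allpairsP; exists (a, k).
split=> /=; first by rewrite addrA.
apply: le_lt_trans ha; rewrite addrA (big_rem k)//= lerDl.
exact: sumr_ge0.
Qed.

End NullFunctions.

Section FiniteColouring.
Context {real : realType}.

(** When [E] means being at distance at most [e], having this for every [e > 0] is total
    boundedness. Colourings multiply and can be pulled back along any map, which is more convenient
    than finite nets. *)
Definition finitely_coloured (T : Type) (E : T -> T -> Prop) :=
  exists (C : finType) (c : T -> C), forall v w, c v = c w -> E v w.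

Lemma finitely_coloured_sub (T : Type) (E E' : T -> T -> Prop) :
  (forall v w, E v w -> E' v w) ->
  finitely_coloured E -> finitely_coloured E'.
Proof. by move=> sub [C [c hc]]; exists C, c => v w /hc /sub. Qed.

Lemma finitely_coloured_comp (S T : Type) (h : S -> T) (E : T -> T -> Prop) :
  finitely_coloured E -> finitely_coloured (fun v w => E (h v) (h w)).
Proof. by move=> [C [c hc]]; exists C, (c \o h) => v w /hc. Qed.

Lemma finitely_coloured_and (T : Type) (E E' : T -> T -> Prop) :
  finitely_coloured E -> finitely_coloured E' ->
  finitely_coloured (fun v w => E v w /\ E' v w).
Proof.
move=> [C [c hc]] [C' [c' hc']].
exists (C * C')%type, (fun v => (c v, c' v)) => v w [/hc ? /hc' ?].
by split.
Qed.

Lemma finitely_coloured_all (T : Type) (I : eqType) (r : seq I)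
    (E : I -> T -> T -> Prop) :
  (forall i, i \in r -> finitely_coloured (E i)) ->
  finitely_coloured (fun v w => forall i, i \in r -> E i v w).
Proof.
elim: r => [|i r IH] hE; first by exists unit, (fun=> tt) => v w _ i.
have [|C [c hc]] := @finitely_coloured_and _ _ _ (hE i (mem_head _ _))
  (IH _); first by move=> j jr; apply: hE; rewrite inE jr orbT.
exists C, c => v w /hc[Ei Er] j; rewrite inE => /orP[/eqP->//|].
exact: Er.
Qed.

(** The colour of [v] is the index of the interval of length [e], counted from [- C], that contains
    [a v]. *)
Lemma finitely_coloured_bounded (T : Type) (a : T -> real) C e : 0 < e ->
  (forall v, `|a v| <= C) -> finitely_coloured (fun v w => `|a v - a w| <= e).
Proof.
move=> e0 aC; pose n v := Num.truncn ((a v + C) / e).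
have a0 v : 0 <= (a v + C) / e.
  have := aC v; rewrite ler_norml => /andP[h _].
  by apply: divr_ge0; [rewrite -lerBlDr sub0r|exact: ltW].
have nN v : (n v < (Num.truncn ((C + C) / e)).+1)%N.
  rewrite ltnS; apply: le_truncn; rewrite ler_pM2r ?invr_gt0// lerD2r.
  exact: le_trans (ler_norm _) (aC v).
exists 'I_(Num.truncn ((C + C) / e)).+1, (fun v => Ordinal (nN v)) => v w.
move=> [nvw].
have := truncn_itv (a0 v); have := truncn_itv (a0 w).
rewrite -/(n v) -/(n w) nvw !ler_pdivlMr ?ltr_pdivrMr//.
rewrite -natr1 mulrDl mul1r; move: ((n w)%:R * e) (a v) (a w) => b x y.
move=> /andP[h1 h2] /andP[h3 h4]; rewrite ler_norml; apply/andP; split; lra.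
Qed.

Lemma finitely_coloured_reps (V : eqType) (E : V -> V -> Prop) :
  finitely_coloured E ->
  exists ks : seq V, forall t, exists2 k, k \in ks & E t k.
Proof.
move=> [C [c hc]].
pose rep (a : C) : option V :=
  if pselect (exists v, c v = a) is left h then Some (sval (cid h)) else None.
exists (pmap rep (enum C)) => t.
have : exists2 k, rep (c t) = Some k & c k = c t.
  rewrite /rep; case: pselect => [h|[]]; last by exists t.
  by exists (sval (cid h)) => //; case: cid.
move=> [k hk kt]; exists k; last exact: hc.
by rewrite mem_pmap -hk map_f// mem_enum.
Qed.

End FiniteColouring.

(** * Almost periodic functions *)

Section SquareDistance.
Context {real : realType} {d : measure_display} {X : measurableType d}.
Variable mu : probability X real.
Implicit Types f g h : bmf real X.

(** Working with the square of the [L^2] distance avoids roots; the price is the factor 2 in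
    [dist2_triangle], the source of most numerical constants below. *)
Definition dist2 f g := mean mu ((f - g) ^+ 2).

Lemma dist2_ge0 f g : 0 <= dist2 f g. Proof. exact: mean_sqr_ge0. Qed.

Lemma dist2C f g : dist2 f g = dist2 g f.
Proof. by rewrite /dist2 -sqrrN opprB. Qed.

Lemma dist2_triangle g f h : dist2 f h <= 2 * dist2 f g + 2 * dist2 g h.
Proof.
rewrite /dist2 -!linearZ -linearD; apply: mean_le => x.
rewrite bmfD !bmfZ !bmfX !bmfB; move: (f x) (g x) (h x) => a b c.
by rewrite -subr_ge0 (_ : _ - _ = (a - b - (b - c)) ^+ 2) ?sqr_ge0//; ring.
Qed.

(** Convexity of the squared norm; [J] is the Cauchy-Schwarz inequality for finite sums against the
    constant 1. *)
Lemma dist2_average (I : eqType) (r : seq I) (F : I -> bmf real X) f e :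
  r != [::] -> (forall i, i \in r -> dist2 f (F i) <= e) ->
  dist2 f ((size r)%:R^-1 *: \sum_(i <- r) F i) <= e.
Proof.
move=> r0 hF; set n := (size r)%:R; have n0 : 0 < n :> real.
  by rewrite ltr0n; case: (r) r0.
have E : f - n^-1 *: \sum_(i <- r) F i = n^-1 *: \sum_(i <- r) (f - F i).
  rewrite sumrB scalerBr; congr (_ - _).
  rewrite big_const_seq count_predT iter_addr_0 -(scaler_nat (size r) f).
  by rewrite scalerA mulVf ?scale1r// gt_eqF.
have J (s : seq I) (a : I -> real) :
    (\sum_(i <- s) a i) ^+ 2 <= (size s)%:R * \sum_(i <- s) a i ^+ 2.
  elim: s => [|i s IH]; first by rewrite !big_nil expr0n mul0r.
  rewrite !big_cons /= -natr1; set A := \sum_(_ <- _) _ in IH *.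
  set B := \sum_(_ <- _) _ in IH *.
  (* The inductive step divides by the length [m] of the tail, so an empty tail is treated apart. *)
  case: s @A @B IH => [|j s] A B IH.
    by rewrite /A /B !big_nil !addr0 add0r mul1r.
  set m := (size (j :: s))%:R in IH *; have m0 : 0 < m :> real by rewrite ltr0n.
  have : 0 <= m^-1 * (m * a i - A) ^+ 2.
    by rewrite mulr_ge0 ?sqr_ge0// invr_ge0 ltW.
  have -> : m^-1 * (m * a i - A) ^+ 2 = m * a i ^+ 2 - 2 * a i * A + A ^+ 2 / m.
    by field; rewrite gt_eqF.
  have : A ^+ 2 / m <= B by rewrite ler_pdivrMr// mulrC.
  move: IH; generalize B A m (a i) (A ^+ 2 / m) => b x y z w; nra.
rewrite /dist2 E.
apply: (@le_trans _ _ (mean mu (n^-1 *: \sum_(i <- r) (f - F i) ^+ 2))).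
  apply: mean_le => x; rewrite bmfX !bmfZ !bmf_sum exprMn.
  apply: (@le_trans _ _ (n^-1 ^+ 2 * (n * \sum_(i <- r) ((f - F i) x) ^+ 2))).
    by rewrite ler_wpM2l ?sqr_ge0// J.
  rewrite expr2 -mulrA mulKf ?gt_eqF// ler_wpM2l ?invr_ge0 ?(ltW n0)//.
rewrite linearZ linear_sum /= mulrC ler_pdivrMr// mulr_natr.
rewrite -iter_addr_0 -count_predT -big_const_seq big_seq [X in _ <= X]big_seq.
exact: ler_sum.
Qed.

Lemma mean_dist2 f g : (mean mu f - mean mu g) ^+ 2 <= dist2 f g.
Proof.
rewrite -linearB; have := mean_CS mu (f - g) 1.
by rewrite mulr1 expr1n mean1 mulr1.
Qed.

End SquareDistance.

(** The acting group is discrete here: measurability is asked of each single map. The topology and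
    the joint measurability return in the last two parts. *)
Record mp_system {real : realType} (G : zmodType) d (X : measurableType d)
    (mu : probability X real) := MpSystem {
  mp_act :> G -> X -> X ;
  mp_act0 : forall x, mp_act 0 x = x ;
  mp_actD : forall g h x, mp_act (g + h) x = mp_act g (mp_act h x) ;
  mp_act_measurable : forall g, measurable_fun setT (mp_act g) ;
  mp_act_preserving :
    forall g A, measurable A -> mu (mp_act g @^-1` A) = mu A }.

Section Koopman.
Context {real : realType} {G : zmodType} {d : measure_display}
  {X : measurableType d} {mu : probability X real}.
Variable T : mp_system G mu.
Implicit Types (f : bmf real X) (g h : G).

Lemma koop_subproof g f : (f \o T g) \in @bmf_pred real d X.
Proof.
rewrite inE; split.
  by apply: measurableT_comp; [exact: bmf_measurable|exact: mp_act_measurable].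
by have [C hC] := bmf_bounded f; exists C => x; exact: hC.
Qed.

Definition koop g f := Bmf (koop_subproof g f).

Lemma koopE g f x : koop g f x = f (T g x). Proof. by []. Qed.

Lemma koop_is_zmod_morphism g : zmod_morphism (koop g).
Proof. by move=> f h; apply: bmf_ext. Qed.
Lemma koop_is_monoid_morphism g : monoid_morphism (koop g).
Proof. by split=> [|f h]; apply: bmf_ext. Qed.
Lemma koop_is_scalable g : scalable_for *:%R (koop g).
Proof. by move=> a f; apply: bmf_ext. Qed.
HB.instance Definition _ g := GRing.isZmodMorphism.Build _ _ (koop g)
  (koop_is_zmod_morphism g).
HB.instance Definition _ g := GRing.isMonoidMorphism.Build _ _ (koop g)
  (koop_is_monoid_morphism g).
HB.instance Definition _ g := GRing.isScalable.Build _ _ _ _ (koop g)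
  (koop_is_scalable g).

Lemma koop0 f : koop 0 f = f.
Proof. by apply: bmf_ext => x; rewrite koopE mp_act0. Qed.

Lemma koop_add g h f : koop g (koop h f) = koop (g + h) f.
Proof. by apply: bmf_ext => x; rewrite !koopE addrC mp_actD. Qed.

Lemma mean_koop g f : mean mu (koop g f) = mean mu f.
Proof.
rewrite /mean /Rintegral; congr fine.
have := @integral_pushforward _ _ _ _ real _ (mp_act_measurable T g) mu setT
  (EFin \o f) _ _ measurableT.
rewrite preimage_setT => H; rewrite -[LHS]H.
- by apply: eq_measure_integral => [|? A mA _];
    [exact: mp_act_measurable|exact: mp_act_preserving].
- apply/measurable_EFinP; exact: bmf_measurable.
- exact: (bmf_integrable mu (koop g f)).
Qed.

Lemma dist2_koop g f f' : dist2 mu (koop g f) (koop g f') = dist2 mu f f'.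
Proof. by rewrite /dist2 -rmorphB -rmorphXn mean_koop. Qed.

(** The memberships in [Gam] stand inside the relation, so that colourings live on all of [G] and
    can be composed with any map into [G]. *)
Definition almost_periodic (Gam : set G) f := forall e, 0 < e ->
  finitely_coloured (fun v w => Gam v -> Gam w ->
    dist2 mu (koop v f) (koop w f) <= e).

Lemma almost_periodic_lift Gam f :
  (forall e, 0 < e -> exists s : seq (bmf real X),
     (forall u, u \in s -> almost_periodic Gam u) /\
     exists2 e', 0 < e' &
       forall v w,
         (forall u, u \in s -> dist2 mu (koop v u) (koop w u) <= e') ->
         dist2 mu (koop v f) (koop w f) <= e) ->
  almost_periodic Gam f.
Proof.
move=> H e /H[s [sap [e' e'0 he']]].
have := finitely_coloured_all (fun u us => sap u us _ e'0).
apply: finitely_coloured_sub => v w h gv gw.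
by apply: he' => u us; exact: h.
Qed.

Lemma almost_periodic_lim Gam f :
  (forall e, 0 < e -> exists2 u, almost_periodic Gam u & dist2 mu u f <= e) ->
  almost_periodic Gam f.
Proof.
move=> H; apply: almost_periodic_lift => e e0.
(* Two triangle inequalities weigh the three errors by 2, 4 and 4. *)
have e10 : 0 < e / 10 by rewrite divr_gt0.
have [g gap hg] := H _ e10.
exists [:: g]; split; first by move=> u; rewrite mem_seq1 => /eqP ->.
exists (e / 10) => // v w /(_ _ (mem_head _ _)) h.
have h1 := dist2_triangle mu (koop v g) (koop v f) (koop w f).
have h2 := dist2_triangle mu (koop w g) (koop v g) (koop w f).
have h3 := dist2_koop v f g; rewrite dist2C in hg.
have h4 := dist2_koop w g f; rewrite (dist2C mu g) in h4.
move: h1 h2 h h3 h4 hg e0; clear.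
move: (dist2 mu (koop v f) (koop w f)) (dist2 mu (koop v f) (koop v g)).
move: (dist2 mu (koop v g) (koop w f)) (dist2 mu (koop v g) (koop w g)).
move: (dist2 mu (koop w g) (koop w f)) (dist2 mu f g).
by move=> a b c d' i j *; lra.
Qed.

(* A single pointwise modulus of continuity gives all the algebraic closure
   properties of almost periodic functions. *)
Lemma almost_periodic_pointwise Gam f (s : seq (bmf real X)) L :
  (forall u, u \in s -> almost_periodic Gam u) ->
  (forall x y, (f x - f y) ^+ 2 <= L * \sum_(u <- s) (u x - u y) ^+ 2) ->
  almost_periodic Gam f.
Proof.
move=> sap hL; apply: almost_periodic_lift => e e0; exists s; split => //.
have C0 : 0 < `|L| * (size s)%:R + 1 by rewrite ltr_wpDl ?mulr_ge0.
exists (e / (`|L| * (size s)%:R + 1)); first by rewrite divr_gt0.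
move=> v w h.
apply: (@le_trans _ _
  (mean mu (`|L| *: \sum_(u <- s) (koop v u - koop w u) ^+ 2))).
  apply: mean_le => x; rewrite bmfX bmfB !koopE bmfZ bmf_sum.
  apply: le_trans (hL _ _) _.
  under [X in _ <= _ * X]eq_bigr do rewrite bmfX bmfB !koopE.
  by rewrite ler_wpM2r ?ler_norm// sumr_ge0// => i _; exact: sqr_ge0.
rewrite linearZ linear_sum /=.
apply: (@le_trans _ _
  (`|L| * \sum_(u <- s) (e / (`|L| * (size s)%:R + 1)))).
  by rewrite ler_wpM2l// big_seq [X in _ <= X]big_seq; apply: ler_sum.
rewrite big_const_seq count_predT iter_addr_0 -[_ *+ size s]mulr_natr.
rewrite [leLHS](_ : _ = e * (`|L| * (size s)%:R / (`|L| * (size s)%:R + 1))).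
  by rewrite ger_pMr// ler_pdivrMr// mul1r lerDl.
by rewrite mulrCA mulrAC !mulrA.
Qed.

Lemma almost_periodic_cst Gam (a : real) :
  almost_periodic Gam (a *: (1 : bmf real X)).
Proof.
apply: (@almost_periodic_pointwise _ _ [::] 0) => // x y.
by rewrite !bmfZ subrr expr0n mul0r.
Qed.

Lemma almost_periodic_scale Gam a f :
  almost_periodic Gam f -> almost_periodic Gam (a *: f).
Proof.
move=> fap; apply: (@almost_periodic_pointwise _ _ [:: f] (a ^+ 2)).
  by move=> u; rewrite mem_seq1 => /eqP ->.
by move=> x y; rewrite !bmfZ big_seq1 -mulrBr exprMn.
Qed.

Lemma almost_periodic_add Gam f (g : bmf real X) :
  almost_periodic Gam f -> almost_periodic Gam g -> almost_periodic Gam (f + g).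
Proof.
move=> fap gap; apply: (@almost_periodic_pointwise _ _ [:: f; g] 2).
  by move=> u; rewrite in_cons mem_seq1 => /orP[] /eqP ->.
move=> x y; rewrite !bmfD big_cons big_seq1.
move: (f x) (f y) (g x) (g y) => a b c d'.
by rewrite -subr_ge0 (_ : _ - _ = (a - b - (c - d')) ^+ 2) ?sqr_ge0//; ring.
Qed.

Lemma almost_periodic_mul Gam f (g : bmf real X) :
  almost_periodic Gam f -> almost_periodic Gam g -> almost_periodic Gam (f * g).
Proof.
move=> fap gap; have [C hC] := bmf_bounded f; have [D hD] := bmf_bounded g.
(* The constant comes from [f x * g x - f y * g y = f x * (g x - g y) + (f x - f y) * g y] and the
   uniform bounds. *)
apply: (@almost_periodic_pointwise _ _ [:: f; g] (2 * (C ^+ 2 + D ^+ 2))).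
  by move=> u; rewrite in_cons mem_seq1 => /orP[] /eqP ->.
move=> x y; rewrite !bmfM big_cons big_seq1.
have : f x ^+ 2 <= C ^+ 2.
  by rewrite -[leLHS]real_normK ?num_real// ler_sqr ?nnegrE// (le_trans _ (hC x)).
have : g y ^+ 2 <= D ^+ 2.
  by rewrite -[leLHS]real_normK ?num_real// ler_sqr ?nnegrE// (le_trans _ (hD y)).
move: (f x) (f y) (g x) (g y) (C ^+ 2) (D ^+ 2) => a b c d' u v hv hu.
have v0 : 0 <= v by apply: le_trans hv; exact: sqr_ge0.
have u0 : 0 <= u by apply: le_trans hu; exact: sqr_ge0.
have E : a * c - b * d' = a * (c - d') + (a - b) * d' by ring.
rewrite E; have -> : 2 * (u + v) * ((a - b) ^+ 2 + (c - d') ^+ 2) =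
  2 * (u * (c - d') ^+ 2) + 2 * (v * (a - b) ^+ 2) +
  (2 * (u * (a - b) ^+ 2) + 2 * (v * (c - d') ^+ 2)) by ring.
apply: (@le_trans _ _ (2 * (a ^+ 2 * (c - d') ^+ 2) + 2 * (d' ^+ 2 * (a - b) ^+ 2))).
  rewrite -subr_ge0 (_ : _ - _ = (a * (c - d') - (a - b) * d') ^+ 2) ?sqr_ge0//.
  by ring.
rewrite -[leLHS]addr0 !lerD ?ler_wpM2l ?ler_wpM2r ?sqr_ge0//.
by rewrite addr_ge0// mulr_ge0// mulr_ge0// sqr_ge0.
Qed.

Lemma almost_periodic_koop Gam f g :
  almost_periodic Gam f -> almost_periodic Gam (koop g f).
Proof.
move=> fap e /fap; apply: finitely_coloured_sub => v w h gv gw.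
by rewrite !koop_add ![_ + g]addrC -!koop_add dist2_koop; exact: h.
Qed.

Lemma almost_periodic_sum Gam (I : Type) (r : seq I) (F : I -> bmf real X) :
  (forall i, almost_periodic Gam (F i)) ->
  almost_periodic Gam (\sum_(i <- r) F i).
Proof.
move=> H; elim/big_ind: _ => //; last exact: almost_periodic_add.
by rewrite -(scale0r (1 : bmf real X)); exact: almost_periodic_cst.
Qed.

(** Fix a decomposition [a + b] of each element and colour it by the colours of [a] and [b]. Passing
    from [a + b] to [a' + b'] through [a' + b], invariance of the distance removes the common
    summand at each step. *)
Lemma almost_periodic_add_sets (A B : set G) f :
  almost_periodic A f -> almost_periodic B f ->
  almost_periodic (set_add A B) f.
Proof.
move=> Aap Bap e e0; have e4 : 0 < e / 4 by rewrite divr_gt0.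
have /choice[dec hdec] : forall v, exists p : G * G,
    set_add A B v -> [/\ A p.1, B p.2 & p.1 + p.2 = v].
  move=> v; have [[a Aa [b Bb ab]]|nv] := pselect (set_add A B v); last by exists (0, 0).
  by exists (a, b).
have h1 := finitely_coloured_comp (fun v => (dec v).1) (Aap _ e4).
have h2 := finitely_coloured_comp (fun v => (dec v).2) (Bap _ e4).
apply: finitely_coloured_sub (finitely_coloured_and h1 h2) => v w [].
move=> {h1 h2} h1 h2 /hdec[Av Bv <-] /hdec[Aw Bw <-].
move: h1 h2 => /(_ Av Aw) h1 /(_ Bv Bw) h2.
move: (dec v) (dec w) h1 h2 => [a b] [a' b'] /= h1 h2 {Av Bv Aw Bw}.
have h3 := dist2_triangle mu (koop (a' + b) f) (koop (a + b) f) (koop (a' + b') f).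
have h4 := dist2_koop b (koop a f) (koop a' f).
have h5 := dist2_koop a' (koop b f) (koop b' f).
rewrite !koop_add !(addrC b) in h4; rewrite !koop_add in h5.
move: h3 h1 h2; rewrite h4 h5; clear.
move: (dist2 mu _ _) (dist2 mu _ _) (dist2 mu _ _) => x y z; lra.
Qed.


End Koopman.

(** * Completeness of uniformly bounded sets of functions in [L^2] *)

Section Completeness.
Context {real : realType} {d : measure_display} {X : measurableType d}.
Variable mu : probability X real.
Implicit Types f g h : bmf real X.

(** Cauchy-Schwarz against the constant 1, in the extended reals because the increments are summed
    there. *)
Lemma mean_norm_le f : (\int[mu]_x `|f x|%:E <= (Num.sqrt (mean mu (f ^+ 2)))%:E)%E.
Proof.
have nP : (fun x => `|f x|) \in @bmf_pred real d X.
  rewrite inE; split; first by apply: measurableT_comp => //; exact: bmf_measurable.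
  by have [C hC] := bmf_bounded f; exists C => x; rewrite normr_id.
pose h := Bmf nP.
have hE : (\int[mu]_x `|f x|%:E)%E = (mean mu h)%:E.
  rewrite /mean /Rintegral fineK//.
  exact: (integrable_fin_num _ (bmf_integrable mu h)).
rewrite hE lee_fin -[leLHS]ger0_norm; last by apply: mean_ge0 => x; rewrite /h /=.
rewrite -sqrtr_sqr ler_wsqrtr//.
have := mean_CS mu h 1; rewrite mulr1 expr1n mean1 mulr1.
move/le_trans; apply; apply: mean_le => x.
by rewrite !bmfX /= real_normK ?num_real.
Qed.

Lemma cvg_of_summable_increments (a : nat -> real) :
  (\sum_(0 <= n <oo) `|a n.+1 - a n|%:E < +oo)%E -> cvgn a.
Proof.
move=> fin.
have le n : \sum_(0 <= k < n) `|a k.+1 - a k| <=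
    fine (\sum_(0 <= n <oo) `|a n.+1 - a n|%:E)%E.
  rewrite -lee_fin fineK; last first.
    by rewrite ge0_fin_numE// nneseries_ge0.
  by rewrite -sumEFin; apply: nneseries_lim_ge => i _; rewrite lee_fin.
have /normed_cvg : cvgn [normed series (telescope a)].
  apply: nondecreasing_is_cvgn.
    by apply: nondecreasing_series => i _ _; exact: normr_ge0.
  exists (fine (\sum_(0 <= n <oo) `|a n.+1 - a n|%:E)%E) => _ [n _ <-].
  exact: le.
rewrite telescopeK => h.
have -> : a = (fun n => (a n - a 0%N) + a 0%N) by apply/funext => n; rewrite subrK.
apply: is_cvgD => //; exact: is_cvg_cst.
Qed.

(* Riesz-Fischer for uniformly bounded sequences *)
Lemma bmf_complete (u : nat -> bmf real X) (C : real) :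
  (forall n x, `|u n x| <= C) ->
  (forall n, dist2 mu (u n.+1) (u n) <= (1 / (2 ^ n.+1)%:R) ^+ 2) ->
  exists f, forall e, 0 < e -> exists N, forall n, (N <= n)%N ->
    dist2 mu (u n) f <= e.
Proof.
(* [S] is the total variation of the sequence at a point. Its integral is at most the sum of
   [1 / 2 ^ n.+1], which is 1, so it is finite almost everywhere. *)
move=> uC ud; pose S x := (\sum_(0 <= n <oo) `|u n.+1 x - u n x|%:E)%E.
have mg n : measurable_fun setT (fun x => `|u n.+1 x - u n x|%:E : \bar real).
  apply/measurable_EFinP/measurableT_comp => //.
  exact: (bmf_measurable (u n.+1 - u n)).
have mS : measurable_fun setT S.
  by apply: ge0_emeasurable_sum => // n x _ _; rewrite lee_fin.
have S0 x : (0 <= S x)%E by apply: nneseries_ge0 => n _ _; rewrite lee_fin.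
have iS : (\int[mu]_x S x < +oo)%E.
  rewrite integral_nneseries//.
  apply: le_lt_trans (ltry 1); apply: le_trans (@epsilon_trick0 real 1 xpredT _) => //.
  apply: lee_nneseries => [n _ _|n _].
    by apply: integral_ge0 => x _; rewrite lee_fin.
  apply: le_trans (mean_norm_le (u n.+1 - u n)) _; rewrite lee_fin.
  apply: le_trans (ler_wsqrtr (ud n)) _.
  by rewrite sqrtr_sqr ger0_norm.
have Sint : mu.-integrable setT S.
  apply/integrableP; split => //.
  by under eq_integral do rewrite gee0_abs//.
pose Om := [set x | (S x < +oo)%E].
have mOm : measurable Om.
  rewrite /Om -[X in measurable X]setTI; exact: emeasurable_fun_infty_o.
(* Cut off in this way the sequence converges at every point, so its limit is measurable and bounded
   by [C]. *)
pose v n x := u n x * \1_Om x.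
have vcvg x : cvgn (v ^~ x).
  rewrite /v indicE; have [xO|xO] := boolP (x \in Om).
    under eq_fun do rewrite mulr1.
    by apply: cvg_of_summable_increments; move: xO; rewrite inE.
  by under eq_fun do rewrite mulr0; exact: is_cvg_cst.
have vC n x : `|v n x| <= C.
  rewrite /v normrM; apply: le_trans (uC n x); rewrite ler_piMr//.
  by rewrite indicE; case: (_ \in _); rewrite ?normr1 ?normr0.
pose F x := limn (v ^~ x).
have mv n : measurable_fun setT (v n).
  by apply: measurable_funM; [exact: bmf_measurable|exact: measurable_indic].
have FP : F \in @bmf_pred real d X.
  rewrite inE; split; first by apply: measurable_fun_cvg mv _ => x _; exact: vcvg.
  exists C => x; rewrite ler_norml; apply/andP; split.
    apply: limr_ge => //; apply: nearW => n.
    by have := vC n x; rewrite ler_norml => /andP[].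
  apply: limr_le => //; apply: nearW => n.
  by have := vC n x; rewrite ler_norml => /andP[].
exists (Bmf FP) => e e0.
have FC x : `|F x| <= C.
  have : `|v n x| @[n --> \oo] --> `|F x| by apply: cvg_norm; exact: vcvg.
  move=> /cvg_lim <- //; apply: limr_le.
    by apply/cvg_ex; exists `|F x|; apply: cvg_norm; exact: vcvg.
  by apply: nearW => n.
have [] := @dominated_convergence _ _ _ mu setT measurableT
  (fun n x => (((u n - Bmf FP) ^+ 2) x)%:E) (fun=> 0%E) (fun=> ((C + C) ^+ 2)%:E).
- by move=> n; apply/measurable_EFinP; exact: bmf_measurable.
- exact: measurable_cst.
- have := integrable_ae measurableT Sint.
  apply: filterS => x /(_ I) Sx _.
  have xO : x \in Om by rewrite inE /Om /= -ge0_fin_numE.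
  have : v n x @[n --> \oo] --> F x by exact: vcvg.
  rewrite /v indicE xO => h.
  apply/fine_cvgP; split; first by apply: nearW.
  have h2 : (u n x * 1 - F x) ^+ 2 @[n --> \oo] --> ((F x - F x) ^+ 2 : real).
    by apply: cvgM; apply: cvgB => //; exact: cvg_cst.
  rewrite subrr expr0n /= in h2.
  rewrite (_ : _ \o _ = (fun n => (u n x * 1 - F x) ^+ 2))//.
  by apply/funext => n; rewrite mulr1; exact: (bmfX (u n - Bmf FP) 2 x).
- exact: (@finite_measure_integrable_cst _ _ _ mu).
- apply: aeW => x n _.
  rewrite gee0_abs; last by rewrite lee_fin bmfX sqr_ge0.
  rewrite lee_fin bmfX -real_normK ?num_real// ler_sqr ?nnegrE//.
    by rewrite bmfB; apply: le_trans (ler_normB _ _) _; rewrite lerD.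
  by rewrite addr_ge0// (le_trans _ (FC x)).
move=> _ + _ => /fine_cvgP[_] /cvgrPdist_le/(_ _ e0)[N _ hN].
exists N => n Nn; have := hN n Nn.
rewrite sub0r normrN; apply: le_trans; apply: le_trans (ler_norm _).
rewrite /= /dist2 /mean /Rintegral le_eqVlt; apply/orP; left; apply/eqP.
congr fine; apply: eq_integral => x _.
by rewrite subr0 ger0_norm//; exact: sqr_ge0.
Qed.

End Completeness.

(** * Hilbert-Schmidt averages and weak mixing *)

(* The kernel [K(x,y) = \sum_i c_i u_i(x) u_i(y)] acts on [h] with operator
   norm at most its norm in [L^2(mu x mu)]; Cauchy-Schwarz in [y] for each
   fixed [x] avoids the product space. *)
Lemma hilbert_schmidt_bound (real : realType) d (X : measurableType d)
    (mu : probability X real) (I : Type) (r : seq I) (c : I -> real)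
    (u : I -> bmf real X) (h : bmf real X) :
  mean mu ((\sum_(i <- r) (c i * mean mu (u i * h)) *: u i) ^+ 2) <=
  (\sum_(i <- r) \sum_(j <- r) c i * c j * mean mu (u i * u j) ^+ 2)
    * mean mu (h ^+ 2).
Proof.
(* [W x] is the integral of [K(x,y)^2] in [y], so its mean is the squared norm of the kernel. *)
pose W : bmf real X := \sum_(i <- r) \sum_(j <- r)
  (c i * c j * mean mu (u i * u j)) *: (u i * u j).
have -> : \sum_(i <- r) \sum_(j <- r) c i * c j * mean mu (u i * u j) ^+ 2 =
          mean mu W.
  rewrite /W linear_sum; apply: eq_bigr => i _; rewrite linear_sum.
  by apply: eq_bigr => j _; rewrite linearZ /= expr2 mulrA.
rewrite mulrC -linearZ; apply: mean_le => x; rewrite bmfX bmfZ mulrC.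
pose K : bmf real X := \sum_(i <- r) (c i * u i x) *: u i.
have -> : W x = mean mu (K ^+ 2).
  rewrite /W bmf_sum expr2 {1}/K mulr_suml linear_sum.
  apply: eq_bigr => i _; rewrite bmf_sum /K mulr_sumr linear_sum.
  apply: eq_bigr => j _; rewrite bmfZ bmfM.
  by rewrite bmf_scaleM linearZ /=; ring.
have -> : (\sum_(i <- r) (c i * mean mu (u i * h)) *: u i) x = mean mu (K * h).
  rewrite bmf_sum /K mulr_suml linear_sum; apply: eq_bigr => i _.
  have -> : (c i * u i x) *: u i * h = (c i * u i x) *: (u i * h).
    by apply: bmf_ext => y; rewrite !(bmfM, bmfZ) mulrA.
  by rewrite bmfZ linearZ /=; ring.
exact: mean_CS.
Qed.

Lemma mean_norm_bound (real : realType) d (X : measurableType d)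
    (mu : probability X real) (h : bmf real X) (C : real) :
  (forall x, `|h x| <= C) -> `|mean mu h| <= C.
Proof.
move=> hC; rewrite ler_norml -{1}(mean_cst mu C) -linearN -{2}(mean_cst mu C).
by apply/andP; split; apply: mean_le => y; rewrite ?bmfN bmfZ bmf1 mulr1;
  have := hC y; rewrite ler_norml => /andP[].
Qed.

Section AveragedProjections.
Context {real : realType} {R : pzRingType} {G : lmodType R}
  {d : measure_display} {X : measurableType d} {mu : probability X real}.
Variable T : mp_system G mu.
Variables (g : G) (f : bmf real X).
Implicit Types (k l : seq R) (h : bmf real X) (t : R).

Let u t := koop T (t *: g) f.
Let M := mean mu (f ^+ 2).

(** Average of the rank one operators [h |-> <u s, h> u s], which are orthogonal projections up to
    normalisation. *)
Definition averaged_projection k h : bmf real X :=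
  (size k)%:R^-1 *: \sum_(s <- k) mean mu (u s * h) *: u s.
Let A := averaged_projection.

(** In the Hilbert-Schmidt inner product, the rank one operators of [u s] and [u t] pair to
    [mean mu (u s * u t) ^+ 2]. Hence [hs_norm2 k] is the squared Hilbert-Schmidt norm of
    [averaged_projection k]. *)
Definition gram k l := \sum_(s <- k) \sum_(t <- l) mean mu (u s * u t) ^+ 2.
Definition hs_norm2 k := gram k k / (size k)%:R ^+ 2.
Definition shift t k := [seq s + t | s <- k].

Lemma orbit_corr_shift r s t : mean mu (u (s + r) * u (t + r)) = mean mu (u s * u t).
Proof.
rewrite /u ![_ + r]addrC !scalerDl -!koop_add -rmorphM; exact: mean_koop.
Qed.

Lemma koop_orbit t s : koop T (t *: g) (u s) = u (s + t).
Proof. by rewrite /u koop_add -scalerDl addrC. Qed.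

Lemma gram_shift t k l : gram (shift t k) (shift t l) = gram k l.
Proof.
rewrite /gram /shift big_map; apply: eq_bigr => s _; rewrite big_map.
by apply: eq_bigr => s' _; rewrite orbit_corr_shift.
Qed.

Lemma hs_norm2_shift t k : hs_norm2 (shift t k) = hs_norm2 k.
Proof. by rewrite /hs_norm2 gram_shift size_map. Qed.

Lemma gram_cat k l : gram (k ++ l) (k ++ l) =
  gram k k + gram k l + (gram l k + gram l l).
Proof.
by rewrite /gram big_cat /= -!big_split /=; congr (_ + _);
  apply: eq_bigr => s _; rewrite big_cat.
Qed.

Lemma hs_norm2_ge0 k : 0 <= hs_norm2 k.
Proof.
rewrite divr_ge0 ?sqr_ge0//.
by apply: sumr_ge0 => s _; apply: sumr_ge0 => t _; exact: sqr_ge0.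
Qed.

Lemma averaged_projection_bound k h :
  mean mu (A k h ^+ 2) <= hs_norm2 k * mean mu (h ^+ 2).
Proof.
have := hilbert_schmidt_bound mu k (fun=> (size k)%:R^-1) u h.
rewrite /A /averaged_projection scaler_sumr.
under eq_bigr do rewrite -scalerA.
move/le_trans; apply; rewrite ler_wpM2r ?mean_sqr_ge0//.
rewrite /hs_norm2 /gram mulr_suml le_eqVlt; apply/orP; left; apply/eqP.
apply: eq_bigr => s _; rewrite mulr_suml; apply: eq_bigr => t _.
by rewrite mulrC -expr2 exprVn.
Qed.

(* parallelogram identity in the Hilbert-Schmidt norm *)
Lemma averaged_projection_dist2 k l h : size l = size k -> k != [::] ->
  dist2 mu (A k h) (A l h) <=
  (2 * hs_norm2 k + 2 * hs_norm2 l - 4 * hs_norm2 (k ++ l)) * mean mu (h ^+ 2).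
Proof.
move=> lk k0; set n := (size k)%:R : real.
have n0 : 0 < n by rewrite ltr0n; case: (k) k0.
(* Signed weights turn the difference of the two operators into a single kernel. The list [k ++ l]
   gives their midpoint, whence the factor 4 in the identity. *)
pose r := [seq (n^-1, s) | s <- k] ++ [seq (- n^-1, s) | s <- l].
have := hilbert_schmidt_bound mu r (fun p => p.1) (fun p => u p.2) h.
have -> : \sum_(p <- r) (p.1 * mean mu (u p.2 * h)) *: u p.2 = A k h - A l h.
  rewrite /r big_cat !big_map /= /A /averaged_projection lk -/n.
  rewrite -scaleNr !scaler_sumr; congr (_ + _);
  by apply: eq_bigr => s _; rewrite scalerA.
move/le_trans; apply; rewrite ler_wpM2r ?mean_sqr_ge0//.
have E (a b : real) (k1 k2 : seq R) :
    \sum_(s <- k1) \sum_(t <- k2) a * b * mean mu (u s * u t) ^+ 2 =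
    a * b * gram k1 k2.
  by rewrite /gram mulr_sumr; apply: eq_bigr => s _; rewrite mulr_sumr.
have -> : \sum_(p <- r) \sum_(q <- r) p.1 * q.1 * mean mu (u p.2 * u q.2) ^+ 2 =
    n^-1 * n^-1 * gram k k + n^-1 * - n^-1 * gram k l +
    (- n^-1 * n^-1 * gram l k + - n^-1 * - n^-1 * gram l l).
  rewrite /r big_cat /= !big_map /= -!E -!big_split /=; congr (_ + _);
  by apply: eq_bigr => s _; rewrite big_cat /= !big_map.
rewrite /hs_norm2 gram_cat size_cat lk natrD -/n.
rewrite le_eqVlt; apply/orP; left; apply/eqP; field.
by rewrite !gt_eqF ?addr_gt0.
Qed.

(** Shifting the list conjugates the operator by a Koopman operator, since the orbit vectors are
    permuted and correlations are invariant. *)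
Lemma averaged_projection_shift t k h :
  A (shift t k) (koop T (t *: g) h) = koop T (t *: g) (A k h).
Proof.
rewrite /A /averaged_projection size_map linearZ /=; congr (_ *: _).
rewrite big_map linear_sum; apply: eq_bigr => s _.
by rewrite linearZ /= koop_orbit -!koop_orbit -rmorphM mean_koop.
Qed.

(** The average over a sumset is an average of shifts of [k], and by the next lemma also of shifts
    of [l]. This lets the operators of two unrelated lists be compared. *)
Lemma averaged_projection_sumset k l h :
  A [seq a + b | a <- k, b <- l] h =
  (size l)%:R^-1 *: \sum_(b <- l) A (shift b k) h.
Proof.
rewrite /A /averaged_projection size_allpairs natrM invfM mulrC -scalerA.
congr (_ *: _); rewrite big_allpairs_dep exchange_big /= scaler_sumr.
by apply: eq_bigr => b _; rewrite size_map big_map.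
Qed.

Lemma averaged_projection_sumset' k l h :
  A [seq a + b | a <- k, b <- l] h =
  (size k)%:R^-1 *: \sum_(a <- k) A (shift a l) h.
Proof.
rewrite /A /averaged_projection size_allpairs natrM invfM -scalerA.
congr (_ *: _); rewrite big_allpairs_dep /= scaler_sumr.
apply: eq_bigr => a _; rewrite size_map big_map; congr (_ *: _).
by apply: eq_bigr => b _; rewrite addrC.
Qed.

(** Supplies the uniform bound required by [bmf_complete]: each coefficient is at most [C ^+ 2] and
    each orbit vector at most [C]. *)
Lemma averaged_projection_sup C x k : (forall y, `|f y| <= C) ->
  `|A k f x| <= C ^+ 3.
Proof.
move=> fC; have C0 : 0 <= C by apply: le_trans (fC x).
have uC s y : `|u s y| <= C by exact: fC.
have mC s : `|mean mu (u s * f)| <= C ^+ 2.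
  by apply: mean_norm_bound => y; rewrite bmfM normrM expr2 ler_pM.
rewrite /A /averaged_projection bmfZ bmf_sum normrM normfV normr_nat.
have [->|k0] := eqVneq k [::]; first by rewrite invr0 mul0r exprn_ge0.
have n0 : 0 < (size k)%:R :> real by rewrite ltr0n; case: (k) k0.
rewrite mulrC ler_pdivrMr//; apply: le_trans (ler_norm_sum _ _ _) _.
rewrite mulr_natr -iter_addr_0 -count_predT -big_const_seq.
apply: ler_sum => s _; rewrite bmfZ normrM exprSr.
by rewrite ler_pM.
Qed.

End AveragedProjections.

Lemma half_le_of_close (real : realFieldType) (a b c : real) :
  c <= a -> a - b <= c / 2 -> c / 2 <= b.
Proof. by move=> *; lra. Qed.

Section WeakMixingDichotomy.
Context {real : realType} {R : pzRingType} {G : lmodType R}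
  {d : measure_display} {X : measurableType d} {mu : probability X real}.
Variable T : mp_system G mu.
Variables (Gam : set G) (g : G) (f : bmf real X).

Let u t := koop T (t *: g) f.
Let M := mean mu (f ^+ 2).
Local Notation A := (averaged_projection T g f).
Local Notation hs := (hs_norm2 T g f).

Let M0 : 0 <= M. Proof. exact: mean_sqr_ge0. Qed.

Lemma mean_koop_sqr v : mean mu (koop T v f ^+ 2) = M.
Proof. by rewrite -rmorphXn mean_koop. Qed.

(** The shift by [t] is moved into the test vector, whose norm does not depend on [t]; bounds on the
    operator thus become uniform in [t]. *)
Lemma averaged_projection_corr k t :
  \sum_(s <- k) mean mu (u (t + s) * f) ^+ 2 =
  (size k)%:R * mean mu (A k (koop T (- t *: g) f) * koop T (- t *: g) f).
Proof.
have [->|k0] := eqVneq k [::]; first by rewrite big_nil mul0r.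
have n0 : (size k)%:R != 0 :> real by rewrite pnatr_eq0; case: (k) k0.
set h := koop T _ f.
rewrite /averaged_projection -bmf_scaleAl linearZ /= mulVKf// mulr_suml linear_sum.
apply: eq_bigr => s _; rewrite -bmf_scaleAl linearZ /= -expr2; congr (_ ^+ 2).
rewrite -[RHS](mean_koop T (t *: g)) rmorphM /= /h /u !koop_add.
by rewrite -!scalerDl subrr scale0r koop0.
Qed.

(** By [averaged_projection_corr] the averages of squared correlations are quadratic forms of the
    operator, and Cauchy-Schwarz bounds their squares by [hs k * M * M], uniformly in [t]. *)
Lemma null_corr_of_small :
  (forall e, 0 < e -> exists2 k, k != [::] & hs k <= e) ->
  null (fun t => mean mu (u t * f)).
Proof.
move=> small; apply: null_sqr => e e0.
have M1 : 0 < M + 1 by rewrite ltr_wpDl.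
have [|k k0 hk] := small ((e / (M + 1)) ^+ 2).
  by rewrite exprn_gt0// divr_gt0.
exists k => // t; under eq_bigr do rewrite ger0_norm ?sqr_ge0//.
rewrite averaged_projection_corr mulrC ler_wpM2r//; set h := koop T _ f.
apply: le_trans (ler_norm _) _; rewrite -(@ler_pXn2r _ 2) ?nnegrE ?(ltW e0)//.
rewrite real_normK ?num_real//; apply: le_trans (mean_CS _ _ _) _.
rewrite mean_koop_sqr.
apply: (@le_trans _ _ (hs k * M * M)).
  rewrite ler_wpM2r//; apply: le_trans (averaged_projection_bound _ _ _ _ _) _.
  by rewrite mean_koop_sqr.
apply: (@le_trans _ _ ((e / (M + 1)) ^+ 2 * (M + 1) ^+ 2)); last first.
  by rewrite -exprMn divfK// gt_eqF.
rewrite -mulrA -expr2 ler_pM ?hs_norm2_ge0 ?sqr_ge0// ler_sqr ?nnegrE ?(ltW M1)//.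
by rewrite lerDl.
Qed.

Variable c : real.
Hypothesis c0 : 0 < c.
Hypothesis c_le : forall k, k != [::] -> c <= hs k.

Let near_min e k := k != [::] /\ hs k <= c + e.

(** Uniform convexity: [k] and its shift both have norm at most [c + e], while their midpoint has
    norm at least [c], so the parallelogram identity forces them together. With
    [averaged_projection_shift], the operator almost commutes with the action. *)
Lemma near_min_shift e t k h : near_min e k ->
  dist2 mu (A k h) (A (shift t k) h) <= 4 * e * mean mu (h ^+ 2).
Proof.
move=> [k0 hk]; have := @averaged_projection_dist2 _ _ _ _ _ _ T g f k (shift t k) h.
rewrite size_map => /(_ erefl k0)/le_trans; apply.
rewrite ler_wpM2r ?mean_sqr_ge0// hs_norm2_shift.
have : c <= hs (k ++ shift t k) by apply: c_le; case: (k) k0.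
have L a b : b <= c + e -> c <= a -> 2 * b + 2 * b - 4 * a <= 4 * e.
  by move=> *; lra.
exact: L.
Qed.

(** Both operators are close to the one of the sumset; [16 = 2 * 4 + 2 * 4]. *)
Lemma near_min_dist2 e k l h : near_min e k -> near_min e l ->
  dist2 mu (A k h) (A l h) <= 16 * e * mean mu (h ^+ 2).
Proof.
move=> hk hl.
have h1 := dist2_triangle mu (A [seq a + b | a <- k, b <- l] h) (A k h) (A l h).
have h2 : dist2 mu (A k h) (A [seq a + b | a <- k, b <- l] h) <=
    4 * e * mean mu (h ^+ 2).
  rewrite averaged_projection_sumset; apply: dist2_average; first by case: hl.
  by move=> b _; exact: near_min_shift.
have h3 : dist2 mu (A l h) (A [seq a + b | a <- k, b <- l] h) <=
    4 * e * mean mu (h ^+ 2).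
  rewrite averaged_projection_sumset'; apply: dist2_average; first by case: hk.
  by move=> b _; exact: near_min_shift.
rewrite dist2C in h3; move: h1 h2 h3.
generalize (dist2 mu (A k h) (A l h)) (mean mu (h ^+ 2)).
generalize (dist2 mu (A k h) (A [seq a + b | a <- k, b <- l] h)).
generalize (dist2 mu (A [seq a + b | a <- k, b <- l] h) (A l h)).
by move=> x y z w *; lra.
Qed.

(** The norm [hs k] is the average of [P (- s)] over [s] in [k], so some [P (- s)] is at least [c];
    by [near_min_shift] the shift by [- s] costs at most [c / 2]. *)
Lemma near_min_corr e k : near_min e k -> 4 * e * M ^+ 2 <= (c / 2) ^+ 2 ->
  c / 2 <= mean mu (A k f * f).
Proof.
move=> hk he; have [k0 _] := hk.
have n0 : 0 < (size k)%:R :> real by rewrite ltr0n; case: (k) k0.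
pose P t := mean mu (A (shift t k) f * f).
have [s sk hs_s] : exists2 s, s \in k & c <= P (- s).
  apply: contrapT => /forall2NP hn; have := c_le k0.
  rewrite leNgt => /negP; apply.
  have -> : hs k = (\sum_(s <- k) P (- s)) / (size k)%:R.
    rewrite /hs_norm2 expr2 invfM mulrA; congr (_ / _).
    rewrite /gram exchange_big mulr_suml; apply: eq_bigr => s' _ /=.
    rewrite /P /averaged_projection size_map -bmf_scaleAl linearZ /= mulrC.
    congr (_ * _); rewrite big_map mulr_suml linear_sum.
    apply: eq_bigr => s _; rewrite -bmf_scaleAl linearZ /= expr2.
    have -> : mean mu (koop T ((s - s') *: g) f * f) =
      mean mu (koop T (s *: g) f * koop T (s' *: g) f); last by [].
    rewrite -(mean_koop T (s' *: g)) rmorphM /= koop_add -scalerDl.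
    by rewrite addrC subrK.
  rewrite ltr_pdivrMr// mulr_natr -iter_addr_0 -count_predT -big_const_seq.
  have : {in k, forall s, P (- s) < c}.
    by move=> s sk; have [//|/negP] := hn s; rewrite -ltNge.
  move: (P) k0; elim: (k) => // a [|b k'] IH P' _ hP.
    by rewrite !big_seq1 hP ?mem_head.
  rewrite [ltLHS]big_cons [ltRHS]big_cons ltrD//; first by rewrite hP ?mem_head.
  by apply: IH => // s sk; rewrite hP// in_cons sk orbT.
have H : (P (- s) - mean mu (A k f * f)) ^+ 2 <= (c / 2) ^+ 2.
  rewrite -linearB -mulrBl; apply: le_trans (mean_CS _ _ _) _.
  apply: le_trans he; rewrite [M ^+ 2]expr2 [4 * e * _]mulrA.
  rewrite -/M.
  apply: ler_wpM2r; first exact: M0.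
  have := near_min_shift (- s) f hk.
  by rewrite dist2C.
have c2 : 0 <= c / 2 by rewrite ltW// divr_gt0.
exact: half_le_of_close hs_s (le_trans (ler_norm _) (norm_le_of_sqr c2 H)).
Qed.

End WeakMixingDichotomy.

(** The four inequalities combine to [z <= 4 * v2 + 8 * w2 + 4 * a + 12 * b], of total weight 28. *)
Lemma dist2_chain (real : realFieldType) (e v1 v2 w1 w2 a b z y : real) :
  z <= 2 * v1 + 2 * y -> y <= 2 * a + 2 * w1 ->
  v1 <= 2 * v2 + 2 * b -> w1 <= 2 * w2 + 2 * b ->
  v2 <= e / 100 -> w2 <= e / 100 -> a <= e / 100 -> b <= e / 100 ->
  0 < e -> z <= e.
Proof. by move=> *; lra. Qed.

Lemma sqr_inv_small (real : realFieldType) (p e : real) :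
  0 < e -> 1 <= p -> e^-1 <= p -> (1 / p) ^+ 2 / 16 <= e.
Proof.
move=> e0 p1 ep; have p0 : 0 < p by apply: lt_le_trans p1.
have h1 : p^-1 <= e by rewrite -[leRHS]invrK lef_pV2// posrE invr_gt0.
have h2 : p^-1 <= 1 by rewrite invf_le1.
have h3 : 0 < p^-1 by rewrite invr_gt0.
rewrite div1r expr2 ler_pdivrMr//; apply: (@le_trans _ _ (e * 1)).
  by apply: ler_pM => //; exact: ltW.
by rewrite ler_pM2l// ler1n.
Qed.

Lemma ratio_bound (real : realFieldType) (s c M : real) : 0 <= M ->
  s <= (c / 4) ^+ 2 / (4 * (M + 1)) -> 4 * s * M <= (c / 4) ^+ 2.
Proof.
move=> M0; rewrite ler_pdivlMr; last by rewrite mulr_gt0// ltr_wpDl.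
move: (_ ^+ 2) (sqr_ge0 (c / 4)) => q q0 h; have [s0|s0] := leP 0 s; first by nra.
by apply: le_trans q0; rewrite mulr_le0_ge0// mulr_ge0_le0// ltW.
Qed.

Lemma gt0_of_close (real : realFieldType) (a b c : real) :
  0 < c -> c / 2 <= a -> a - b <= c / 4 -> 0 < b.
Proof. by move=> *; lra. Qed.

Section WeakMixing.
Context {real : realType} {R : pzRingType} {G : lmodType R}
  {d : measure_display} {X : measurableType d} {mu : probability X real}.
Variable T : mp_system G mu.
Implicit Types (Gam : set G) (g : G) (f F : bmf real X) (k : seq R).

Lemma averaged_projection_ap Gam g f k h : almost_periodic T Gam f ->
  almost_periodic T Gam (averaged_projection T g f k h).
Proof.
move=> fap; apply/almost_periodic_scale/almost_periodic_sum => s.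
exact/almost_periodic_scale/almost_periodic_koop.
Qed.

(** The operator has finite rank and sees [h] only through finitely many coefficients. Colouring
    these bounded numbers therefore colours the image. *)
Lemma averaged_projection_coef (C e : real) g f k h h' : 0 <= e ->
  (forall x, `|f x| <= C) ->
  (forall s, s \in k ->
     `|mean mu (koop T (s *: g) f * h) - mean mu (koop T (s *: g) f * h')| <= e) ->
  dist2 mu (averaged_projection T g f k h) (averaged_projection T g f k h') <=
  (e * C) ^+ 2.
Proof.
move=> e0 fC he; rewrite -[leRHS](mean_cst mu); apply: mean_le => x.
have C0 : 0 <= C by apply: le_trans (fC x).
rewrite bmfX bmfZ bmf1 mulr1 bmfB !bmfZ !bmf_sum -mulrBr -sumrB.
have [->|k0] := eqVneq k [::].
  by rewrite big_nil mulr0 expr0n sqr_ge0.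
have n0 : 0 < (size k)%:R :> real by rewrite ltr0n; case: (k) k0.
rewrite -[leLHS]real_normK ?num_real// ler_sqr ?nnegrE ?mulr_ge0//.
rewrite normrM normfV normr_nat mulrC ler_pdivrMr//.
apply: le_trans (ler_norm_sum _ _ _) _.
rewrite mulr_natr -iter_addr_0 -count_predT -big_const_seq.
rewrite big_seq [leRHS]big_seq; apply: ler_sum => s sk.
rewrite !bmfZ -mulrBl normrM ler_pM//; first exact: he.
exact: fC.
Qed.

(* An operator that almost commutes with the action and has precompact image
   maps [f] to an almost periodic function. *)
Lemma almost_periodic_averaged_lim (c : real) g f F :
  (forall k, k != [::] -> c <= hs_norm2 T g f k) ->
  (forall e, 0 < e -> exists k, exists e', [/\ k != [::],
     hs_norm2 T g f k <= c + e', 4 * e' * mean mu (f ^+ 2) <= e &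
     dist2 mu (averaged_projection T g f k f) F <= e]) ->
  almost_periodic T [set t *: g | t in [set: R]] F.
Proof.
move=> cle lim e e0; have e100 : 0 < e / 100 by rewrite divr_gt0.
have [k [e' [k0 hk he' kF]]] := lim _ e100.
have [C fC] := bmf_bounded f.
pose a s v := mean mu (koop T (s *: g) f * koop T v f).
have a_bd s v : `|a s v| <= C * C.
  apply: mean_norm_bound => x; rewrite bmfM normrM.
  by apply: ler_pM => //; exact: fC.
have C1 : 0 < C ^+ 2 + 1 by rewrite ltr_wpDl ?sqr_ge0.
(* The bound by 1 gives [eta ^+ 2 <= eta], so that [(eta * C) ^+ 2] is at most
   [eta * (C ^+ 2 + 1)]. *)
pose eta := Num.min 1 (e / 100 / (C ^+ 2 + 1)).
have eta0 : 0 < eta by rewrite lt_min ltr01 divr_gt0.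
have eta_le : (eta * C) ^+ 2 <= e / 100.
  have h1 : eta <= 1 by rewrite ge_min lexx.
  have h2 : eta <= e / 100 / (C ^+ 2 + 1) by rewrite ge_min lexx orbT.
  apply: (@le_trans _ _ (eta * (C ^+ 2 + 1))); last by rewrite -ler_pdivlMr.
  rewrite exprMn expr2 -mulrA ler_pM2l//.
  apply: (@le_trans _ _ (1 * C ^+ 2)); first by rewrite ler_wpM2r ?sqr_ge0.
  by rewrite mul1r lerDl.
have := finitely_coloured_all (I := R) (r := k)
  (fun s _ => finitely_coloured_bounded eta0 (a_bd s)).
apply: finitely_coloured_sub => v w + [t _ tv] [t' _ tw].
rewrite -{}tv -{}tw => hvw.
(* [F] is close to the image of [f]; moving the action through the operator shifts [k], and near
   minimality undoes this shift. *)
have key s : dist2 mu (koop T (s *: g) F)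
    (averaged_projection T g f k (koop T (s *: g) f)) <=
  2 * dist2 mu (koop T (s *: g) F) (koop T (s *: g) (averaged_projection T g f k f))
   + 2 * (e / 100).
  apply: le_trans (dist2_triangle _ (koop T (s *: g) (averaged_projection T g f k f)) _ _) _.
  rewrite lerD2l ler_pM2l// -averaged_projection_shift dist2C.
  apply: le_trans he'; rewrite -(mean_koop_sqr T f (s *: g)).
  exact: (near_min_shift cle _ _ (conj k0 hk)).
apply: (dist2_chain (dist2_triangle _ _ _ _) (dist2_triangle _
   (averaged_projection T g f k (koop T (t' *: g) f)) _ _) (key t) _ _ _ _ _ e0).
- by rewrite dist2C; exact: key t'.
- by rewrite dist2_koop dist2C.
- by rewrite dist2_koop dist2C; exact: kF.
- apply: le_trans eta_le; apply: averaged_projection_coef => //; exact: ltW.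
- exact: lexx.
Qed.

(** Let [c] be the infimum of the Hilbert-Schmidt norms. If it is 0, [null_corr_of_small] applies.
    Otherwise the images of [f] under near minimisers form a Cauchy sequence, and [near_min_corr]
    keeps the limit [F] correlated with [f]. *)
Lemma weak_mixing_dichotomy Gam g f :
  almost_periodic T Gam f -> mean mu f = 0 ->
  null (fun t : R => mean mu (koop T (t *: g) f * f)) \/
  exists F, [/\ almost_periodic T Gam F,
    almost_periodic T [set t *: g | t in [set: R]] F,
    mean mu F = 0 & 0 < mean mu (F * f)].
Proof.
move=> fap f0; pose M := mean mu (f ^+ 2).
have M0 : 0 <= M by exact: mean_sqr_ge0.
have M1 : 0 < M + 1 by rewrite ltr_wpDl.
(* The empty list is excluded: its norm is 0 by the convention on division. *)
pose Q := [set hs_norm2 T g f k | k in [set k : seq R | k != [::]]].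
have Qinf : has_inf Q.
  split; first by exists (hs_norm2 T g f [:: 0]); exists [:: 0].
  by exists 0 => _ [k _ <-]; exact: hs_norm2_ge0.
pose c := inf Q.
have cle k : k != [::] -> c <= hs_norm2 T g f k.
  by move=> k0; apply: ge_inf; [case: Qinf|exists k].
have cnear e : 0 < e -> exists2 k, k != [::] & hs_norm2 T g f k <= c + e.
  by move=> /(inf_adherent)/(_ Qinf)[_ [k k0 <-] /ltW]; exists k.
have [c0|c0] := leP c 0.
  left; apply: null_corr_of_small => e /cnear[k k0 hk]; exists k => //.
  by apply: le_trans hk _; rewrite gerDr.
right; have [C fC] := bmf_bounded f.
(* Chosen so that [16 * eps n * M] is below the increment allowed by [bmf_complete]. *)
pose eps n : real := (1 / (2 ^ n.+1)%:R) ^+ 2 / (16 * (M + 1)).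
have eps0 n : 0 < eps n.
  by rewrite divr_gt0 ?mulr_gt0// exprn_gt0// divr_gt0// ltr0n expn_gt0.
have /choice[k hk] : forall n, exists k,
    k != [::] /\ hs_norm2 T g f k <= c + eps n.
  by move=> n; have [k] := cnear _ (eps0 n); exists k.
have eps_mono m n : (m <= n)%N -> eps n <= eps m.
  move=> mn; rewrite ler_pM2r ?invr_gt0 ?mulr_gt0//.
  rewrite ler_sqr ?nnegrE ?divr_ge0// !div1r lef_pV2 ?posrE ?ltr0n ?expn_gt0//.
  by rewrite ler_nat leq_exp2l.
have eps_small e : 0 < e -> exists N, forall n, (N <= n)%N -> eps n * (M + 1) <= e.
  move=> e0; exists (Num.truncn e^-1) => n hn.
  rewrite (_ : _ * _ = (1 / (2 ^ n.+1)%:R) ^+ 2 / 16); last first.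
    by rewrite /eps invfM mulrA divfK// gt_eqF.
  apply: sqr_inv_small => //; first by rewrite ler1n expn_gt0.
  apply: le_trans (ltW (truncnS_gt _)) _.
  by rewrite ler_nat (leq_trans _ (ltnW (ltn_expl n.+1 (ltnSn 1)))).
have mono n m : (m <= n)%N -> k n != [::] /\ hs_norm2 T g f (k n) <= c + eps m.
  move=> mn; have [kn0 hkn] := hk n; split => //.
  by apply: le_trans hkn _; rewrite lerD2l eps_mono.
pose u n := averaged_projection T g f (k n) f.
have [||F hF] := @bmf_complete _ _ _ mu u (C ^+ 3).
- by move=> n x; exact: averaged_projection_sup.
- move=> n; apply: le_trans (near_min_dist2 cle f (mono n.+1 n _) (mono n n _)) _ => //.
  rewrite -/M -mulrA; apply: (@le_trans _ _ (16 * (eps n * (M + 1)))).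
    by rewrite ler_pM2l// ler_pM2l// lerDl.
  by rewrite mulrCA /eps divfK// gt_eqF// mulr_gt0.
have lim e : 0 < e -> exists2 n, eps n * (M + 1) <= e & dist2 mu (u n) F <= e.
  move=> e0; have [N1 h1] := eps_small _ e0; have [N2 h2] := hF _ e0.
  by exists (maxn N1 N2); [apply: h1; rewrite leq_maxl|apply: h2; rewrite leq_maxr].
have epsM n : eps n * M <= eps n * (M + 1) by rewrite ler_pM2l// lerDl.
exists F; split.
- apply: almost_periodic_lim => e /lim[n _ hn]; exists (u n) => //.
  exact: averaged_projection_ap.
- apply: almost_periodic_averaged_lim cle _ => e e0.
  have [|n hn1 hn2] := lim (e / 4); first by rewrite divr_gt0.
  exists (k n), (eps n); have [? ?] := hk n; split => //.
    rewrite -mulrA mulrC -ler_pdivlMr//; exact: le_trans (epsM n) hn1.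
  by apply: le_trans hn2 _; rewrite ler_pdivrMr// ler_peMr ?ler1n// ltW.
- have mu0 n : mean mu (u n) = 0.
    rewrite /u /averaged_projection linearZ linear_sum /= big1 ?mulr0// => s _.
    by rewrite linearZ /= mean_koop f0 mulr0.
  apply/eqP; rewrite -sqrf_eq0; apply/eqP/le_anti; rewrite sqr_ge0 andbT.
  apply/ler_addgt0Pl => e /lim[n _ hn]; rewrite addr0; apply: le_trans hn.
  by have := mean_dist2 mu (u n) F; rewrite mu0 sub0r sqrrN.
- have c4 : 0 < c / 4 by rewrite divr_gt0.
  (* At this precision the correlation of [u n] with [f] is at least [c / 2], and replacing [u n] by
     [F] changes it by at most [c / 4]. *)
  have e0 : 0 < (c / 4) ^+ 2 / (4 * (M + 1)) by rewrite divr_gt0 ?mulr_gt0 ?exprn_gt0.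
  have [n hn1 hn2] := lim _ e0.
  have h1 : c / 2 <= mean mu (u n * f).
    apply: (near_min_corr c0 cle (hk n)); rewrite -/M.
    apply: (@le_trans _ _ (4 * (eps n * (M + 1)) * M)).
      by rewrite expr2 mulrA ler_wpM2r// -mulrA ler_pM2l.
    apply: le_trans (ratio_bound M0 hn1) _.
    by rewrite ler_sqr ?nnegrE ?divr_ge0 ?(ltW c0)// ler_pM2l// lef_pV2 ?posrE// ler_nat.
  have h2 : `|mean mu (u n * f) - mean mu (F * f)| <= c / 4.
    apply: norm_le_of_sqr; first exact: ltW.
    rewrite -linearB -mulrBl; apply: le_trans (mean_CS _ _ _) _.
    apply: le_trans (ratio_bound M0 hn2).
    rewrite -/(dist2 mu (u n) F) -/M; apply: ler_wpM2r; first exact: M0.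
    by apply: ler_peMl; rewrite ?dist2_ge0 ?ler1n.
  exact: gt0_of_close c0 h1 (le_trans (ler_norm _) h2).
Qed.

End WeakMixing.

(** * Multiple weak mixing *)

(** Accounting for [van_der_Corput]: the [psi] term, the [e1] term and the term [m * (e * n / 4)]
    each take at most a quarter of [e * (n * m)]. *)
Lemma vdC_arith (real : realFieldType) (e n m B D e1 e2 s2 psi : real) :
  0 < e -> 0 < n -> 0 < m -> 0 <= B -> 0 <= D ->
  e1 = e ^+ 2 / (4 * (B * D + 1)) -> e2 = e ^+ 2 * n ^+ 2 / (4 * (B + 1)) ->
  psi <= e2 * m -> s2 <= B * (psi + m * (D * (n * (e1 * n)))) ->
  s2 / (e * n) + m * (e * n / 4) <= e * (n * m).
Proof.
move=> e0 n0 m0 B0 D0 e1E e2E hpsi hs2.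
have BD1 : 0 < 4 * (B * D + 1) by rewrite mulr_gt0// ltr_wpDl// mulr_ge0.
have B1 : 0 < 4 * (B + 1) by rewrite mulr_gt0// ltr_wpDl.
have h1 : 4 * (B * D * e1) <= e ^+ 2.
  have : e1 * (4 * (B * D + 1)) = e ^+ 2 by rewrite e1E divfK// gt_eqF.
  have : 0 <= e1 by rewrite e1E divr_ge0 ?sqr_ge0// ltW.
  by move=> ? ?; lra.
have h2 : 4 * (B * e2) <= e ^+ 2 * n ^+ 2.
  have : e2 * (4 * (B + 1)) = e ^+ 2 * n ^+ 2 by rewrite e2E divfK// gt_eqF.
  have : 0 <= e2.
    by rewrite e2E; apply: divr_ge0; [rewrite mulr_ge0 ?sqr_ge0|exact: ltW].
  by move=> ? ?; lra.
have en0 : 0 < e * n by rewrite mulr_gt0.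
rewrite -lerBrDr ler_pdivrMr//; apply: le_trans hs2 _.
have -> : (e * (n * m) - m * (e * n / 4)) * (e * n) =
  m * (e ^+ 2 * n ^+ 2) / 4 + m * (n ^+ 2 * e ^+ 2) / 4
  + m * (e ^+ 2 * n ^+ 2) / 4 by field.
have h3 : B * psi <= m * (e ^+ 2 * n ^+ 2) / 4.
  apply: (@le_trans _ _ (B * (e2 * m))); first by rewrite ler_wpM2l.
  rewrite ler_pdivlMr// (_ : B * (e2 * m) * 4 = m * (4 * (B * e2))); last by ring.
  by rewrite ler_pM2l.
have h4 : B * (m * (D * (n * (e1 * n)))) <= m * (n ^+ 2 * e ^+ 2) / 4.
  rewrite ler_pdivlMr// (_ : _ * 4 = m * (n ^+ 2 * (4 * (B * D * e1)))); last by ring.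
  by rewrite ler_pM2l// ler_pM2l// exprn_gt0.
rewrite mulrDr -[leLHS]addr0 !lerD//.
by rewrite divr_ge0// mulr_ge0 ?mulr_ge0 ?sqr_ge0// ltW.
Qed.

Lemma amgm_quarter (real : realFieldType) (x a : real) :
  0 < a -> x <= x ^+ 2 / a + a / 4.
Proof.
move=> a0; rewrite -subr_ge0.
have -> : x ^+ 2 / a + a / 4 - x = (x - a / 2) ^+ 2 / a by field; rewrite gt_eqF.
by rewrite divr_ge0 ?sqr_ge0// ltW.
Qed.

Section VanDerCorput.
Context {real : realType} {R : zmodType}
  {d : measure_display} {X : measurableType d} {mu : probability X real}.

(** For a finite list [k], the sum of the squared correlations is the correlation of [f] with one
    combination of the [W (r + a)]. Cauchy-Schwarz bounds it by pair correlations, and averaging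
    over a sumset of [k] and [l] treats [theta] by [k] and the errors [E] by [l]. *)
Lemma van_der_Corput (W : R -> bmf real X) (f : bmf real X)
    (E : R -> R -> R -> real) (theta : R -> real) (D K : real) :
  0 <= D -> (forall t, `|mean mu (f * W t)| <= K) ->
  (forall a b, null (E a b)) -> null theta ->
  (forall r a b, `|mean mu (W (r + a) * W (r + b))| <=
     `|E a b r| + D * `|theta (a - b)|) ->
  null (fun t => mean mu (f * W t)).
Proof.
move=> D0 hK hE htheta hW; apply: null_sqr => e e0.
pose B := mean mu (f ^+ 2) * K ^+ 2.
have B0 : 0 <= B by rewrite mulr_ge0 ?sqr_ge0 ?mean_sqr_ge0.
pose e1 := e ^+ 2 / (4 * (B * D + 1)).
have e1_gt0 : 0 < e1.
  by rewrite divr_gt0 ?exprn_gt0// mulr_gt0// ltr_wpDl// mulr_ge0.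
have [k k0 hk] := htheta _ e1_gt0.
have n0 : 0 < (size k)%:R :> real by rewrite ltr0n; case: (k) k0.
pose Psi r := \sum_(a <- k) \sum_(b <- k) `|E a b r|.
have hPsi : null Psi.
  by apply: null_sum => a; apply: null_sum => b; exact: null_norm.
pose e2 := e ^+ 2 * (size k)%:R ^+ 2 / (4 * (B + 1)).
have e2_gt0 : 0 < e2.
  by rewrite divr_gt0 ?mulr_gt0 ?exprn_gt0// ltr_wpDl.
(* [l] comes after [k], since [Psi] collects the finitely many errors [E a b] with [a], [b] in
   [k]. *)
have [l l0 hl] := hPsi _ e2_gt0.
have m0 : 0 < (size l)%:R :> real by rewrite ltr0n; case: (l) l0.
exists [seq a + b | a <- k, b <- l].
  by case: k k0 {hk n0 Psi hPsi e2 e2_gt0 hl} => // a k _; case: l l0 {m0}.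
move=> t; rewrite big_allpairs_dep exchange_big size_allpairs natrM /=.
pose S r := \sum_(a <- k) mean mu (f * W (r + a)) ^+ 2.
have S2 r : S r ^+ 2 <= B * (Psi r + D * ((size k)%:R * (e1 * (size k)%:R))).
  pose x a := mean mu (f * W (r + a)).
  have SE : S r = mean mu (f * \sum_(a <- k) x a *: W (r + a)).
    rewrite mulr_sumr linear_sum; apply: eq_bigr => a _.
    have -> : f * (x a *: W (r + a)) = x a *: (f * W (r + a)).
      by rewrite mulrC -bmf_scaleAl mulrC.
    by rewrite linearZ.
  rewrite SE; apply: le_trans (mean_CS _ _ _) _.
  rewrite -mulrA ler_wpM2l ?mean_sqr_ge0//.
  have -> : mean mu ((\sum_(a <- k) x a *: W (r + a)) ^+ 2) =
     \sum_(a <- k) \sum_(b <- k) x a * x b * mean mu (W (r + a) * W (r + b)).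
    rewrite expr2 mulr_suml linear_sum; apply: eq_bigr => a _.
    rewrite mulr_sumr linear_sum; apply: eq_bigr => b _.
    by rewrite bmf_scaleM linearZ.
  apply: (@le_trans _ _ (\sum_(a <- k) \sum_(b <- k)
     (K ^+ 2 * (`|E a b r| + D * `|theta (a - b)|)))).
    apply: ler_sum => a _; apply: ler_sum => b _.
    apply: le_trans (ler_norm _) _; rewrite !normrM expr2.
    by rewrite ler_pM// ?mulr_ge0// ler_pM// ?hK.
  under eq_bigr do rewrite -mulr_sumr.
  rewrite -mulr_sumr ler_wpM2l ?sqr_ge0// /Psi.
  under eq_bigr do rewrite big_split /=.
  rewrite big_split /= lerD2l.
  under eq_bigr do rewrite -mulr_sumr.
  rewrite -mulr_sumr ler_wpM2l// exchange_big /=.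
  rewrite mulr_natl -iter_addr_0 -count_predT -big_const_seq.
  (* The averages of [theta] are small uniformly in the translation, here by [- b]. *)
  apply: ler_sum => b _; apply: le_trans (hk (- b)).
  by rewrite le_eqVlt; apply/orP; left; apply/eqP; apply: eq_bigr => a _;
    rewrite addrC.
pose n := (size k)%:R : real; pose m := (size l)%:R : real.
apply: (@le_trans _ _ (\sum_(s <- l) (S (t + s) ^+ 2 / (e * n) + e * n / 4))).
  apply: ler_sum => s _; apply: le_trans (amgm_quarter _ (mulr_gt0 e0 n0)).
  rewrite le_eqVlt; apply/orP; left; apply/eqP; apply: eq_bigr => a _.
  by rewrite ger0_norm ?sqr_ge0// (addrC a) addrA.
rewrite big_split /= -mulr_suml big_const_seq count_predT iter_addr_0.
rewrite -[_ *+ size l]mulr_natl.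
apply: (vdC_arith e0 n0 m0 B0 D0 erefl erefl (psi := \sum_(s <- l) Psi (t + s))).
  apply: le_trans (hl t); apply: ler_sum => s _; exact: ler_norm.
apply: le_trans (ler_sum _ (fun s _ => S2 (t + s))) _.
rewrite -mulr_sumr ler_wpM2l// big_split /= lerD2l.
by rewrite big_const_seq count_predT iter_addr_0 -[_ *+ size l]mulr_natl.
Qed.

End VanDerCorput.

Section MultipleMixing.
Context {real : realType} {R : pzRingType} {G : lmodType R}
  {d : measure_display} {X : measurableType d} {mu : probability X real}.
Variable T : mp_system G mu.
Variable Gam : set G.
Hypothesis mixing : forall g, ~ Gam g -> forall f : bmf real X,
  almost_periodic T Gam f -> mean mu f = 0 ->
  null (fun t : R => mean mu (koop T (t *: g) f * f)).
Implicit Types (s : seq (G * bmf real X)).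

Let distinct (p q : G * bmf real X) : bool := `[< ~ Gam (q.1 - p.1) >].
Let prodk s t := \prod_(p <- s) koop T (t *: p.1) p.2.

Lemma prodk_bounded s : exists C, forall t x, `|prodk s t x| <= C.
Proof.
rewrite /prodk; elim: s => [|p s [C hC]].
  by exists 1 => t x; rewrite big_nil bmf1 normr1.
have [D hD] := bmf_bounded p.2; exists (D * C) => t x.
by rewrite big_cons bmfM normrM ler_pM//; exact: hD.
Qed.

Lemma prod_corr_bounded s : exists2 C : real, 0 <= C & forall a b : R,
  `|\prod_(p <- s) mean mu (koop T (a *: p.1) p.2 * koop T (b *: p.1) p.2)|
    <= C.
Proof.
elim: s => [|p s [C C0 hC]].
  by exists 1 => // a b; rewrite big_nil normr1.
have [D hD] := bmf_bounded p.2; exists (D * D * C).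
  by rewrite mulr_ge0// -expr2 sqr_ge0.
move=> a b; rewrite big_cons normrM ler_pM//.
by apply: mean_norm_bound => x; rewrite bmfM normrM ler_pM//; exact: hD.
Qed.

(** Induction on the number of factors. The constant part of the first function is covered by the
    shorter product, the centred part by van der Corput. There the pair correlations, translated
    back by [r *: h], again involve a shorter product, with elements [p.1 - h]; these avoid [Gam]
    and keep their mutual differences. *)
Lemma multiple_mixing s : (forall p, p \in s -> ~ Gam p.1) ->
  pairwise distinct s -> (forall p, p \in s -> almost_periodic T Gam p.2) ->
  forall f : bmf real X,
  null (fun t : R => mean mu (f * \prod_(p <- s) koop T (t *: p.1) p.2) -
              mean mu f * \prod_(p <- s) mean mu p.2).
Proof.
have [n] := ubnP (size s); elim: n s => // n IHn [|[h f1] s] /=.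
  move=> _ _ _ _ f; refine (@null_le _ _ _ (fun=> 0) 0 _ null0) => t.
  by rewrite !big_nil !mulr1 subrr normr0 mul0r.
rewrite ltnS => sn hGam /andP[/allP hh hs] hap f.
have f1ap : almost_periodic T Gam f1 by apply: (hap (h, f1)); exact: mem_head.
have sGam p : p \in s -> ~ Gam p.1 by move=> ps; apply: hGam; rewrite in_cons ps orbT.
have sap p : p \in s -> almost_periodic T Gam p.2.
  by move=> ps; apply: hap; rewrite in_cons ps orbT.
pose a := mean mu f1; pose f1' := f1 - a *: (1 : bmf real X).
have f1'0 : mean mu f1' = 0 by rewrite linearB /= mean_cst subrr.
have f1'ap : almost_periodic T Gam f1'.
  rewrite /f1' -scaleNr; apply: almost_periodic_add => //.
  exact: almost_periodic_cst.
have split_ t : mean mu (f * \prod_(p <- (h, f1) :: s) koop T (t *: p.1) p.2) -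
    mean mu f * \prod_(p <- (h, f1) :: s) mean mu p.2 =
  mean mu (f * (koop T (t *: h) f1' * prodk s t)) +
  a * (mean mu (f * prodk s t) - mean mu f * \prod_(p <- s) mean mu p.2).
  rewrite !big_cons /= -/(prodk s t) -/a.
  have -> : koop T (t *: h) f1' = koop T (t *: h) f1 - a *: (1 : bmf real X).
    exact: bmf_ext.
  have -> : f * ((koop T (t *: h) f1 - a *: (1 : bmf real X)) * prodk s t) =
      f * (koop T (t *: h) f1 * prodk s t) - a *: (f * prodk s t).
    by rewrite mulrBl mulrBr -bmf_scaleAl mul1r (mulrC f (a *: _)) -bmf_scaleAl
      (mulrC f (prodk s t)).
  rewrite [X in _ = X + _]linearB [X in _ = _ - X + _]linearZ /=.
  by rewrite mulrBr addrA subrK (mulrCA (mean mu f)).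
under eq_fun do rewrite split_.
have aux : null (fun t : R => a *
    (mean mu (f * prodk s t) - mean mu f * \prod_(p <- s) mean mu p.2)).
  by refine (@null_le _ _ _ _ `|a| _ (IHn s sn sGam hs sap f)) => t;
    rewrite normrM.
apply: (@null_add _ _ (fun t => mean mu (f * (koop T (t *: h) f1' * prodk s t)))
  _ _ aux).
have [D D0 hD] := prod_corr_bounded s.
have [C hC] := bmf_bounded f.
have [C' hC'] := prodk_bounded ((h, f1') :: s).
pose W t := koop T (t *: h) f1' * prodk s t.
pose F b c (p : G * bmf real X) := koop T (b *: p.1) p.2 * koop T (c *: p.1) p.2.
pose s' b c := [seq (p.1 - h, F b c p) | p <- s].
pose E b c r := mean mu (F b c (h, f1') * \prod_(p <- s' b c) koop T (r *: p.1) p.2)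
   - mean mu (F b c (h, f1')) * \prod_(p <- s' b c) mean mu p.2.
apply: (@van_der_Corput _ _ _ _ mu W f E
  (fun t => mean mu (koop T (t *: h) f1' * f1')) D (C * C')) => //.
- move=> t; apply: mean_norm_bound => x; rewrite bmfM normrM ler_pM//.
  by have := hC' t x; rewrite /prodk big_cons.
- move=> b c; apply: IHn.
  + by rewrite size_map.
  + by move=> _ /mapP[p ps ->] /=; apply/asboolP/(hh p ps).
  + rewrite pairwise_map; apply: sub_pairwise hs => p q /asboolP hpq.
    by apply/asboolP => /=; rewrite opprB addrA subrK.
  + move=> _ /mapP[p ps ->] /=.
    by apply: almost_periodic_mul; apply: almost_periodic_koop; exact: sap.
- by apply: mixing => //; apply: (hGam (h, f1)); exact: mem_head.
- move=> r b c.
  have -> : mean mu (W (r + b) * W (r + c)) =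
      mean mu (F b c (h, f1') * \prod_(p <- s' b c) koop T (r *: p.1) p.2).
    rewrite -[RHS](mean_koop T (r *: h)) rmorphM /= rmorph_prod.
    congr (mean mu _); rewrite /W mulrACA /F /=; congr (_ * _).
      by rewrite rmorphM /= !koop_add -!scalerDl.
    rewrite /prodk /s' -big_split big_map /=; apply: eq_bigr => p _.
    by rewrite koop_add -scalerDr (addrC h) subrK rmorphM /= !koop_add
      -!scalerDl.
  rewrite -[X in `|X| <= _](subrK (mean mu (F b c (h, f1')) * \prod_(p <- s' b c) mean mu p.2)).
  apply: le_trans (ler_normD _ _) _; rewrite lerD2l normrM mulrC.
  apply: ler_pM; [exact: normr_ge0|exact: normr_ge0| |].
    by rewrite /s' big_map; exact: hD.
  (* By stationarity the correlation of [f1'] at times [b] and [c] depends on [b - c] alone, and it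
     is null by [mixing]. *)
  have := orbit_corr_shift T h f1' c (b - c) 0.
  by rewrite subrK add0r scale0r koop0 /F /= => ->.
Qed.

End MultipleMixing.

(** * Almost periodic sets *)

Definition clip {real : realFieldType} (a : real) := Num.min 1 (Num.max 0 a).

Lemma clip_le0 (real : realFieldType) (a : real) : a <= 0 -> clip a = 0.
Proof. by move=> a0; rewrite /clip max_l// min_r. Qed.

Lemma clip_ge1 (real : realFieldType) (a : real) : 1 <= a -> clip a = 1.
Proof. by move=> a1; rewrite /clip max_r ?min_l// (le_trans ler01). Qed.

Lemma clip_id (real : realFieldType) (a : real) : 0 <= a <= 1 -> clip a = a.
Proof. by move=> /andP[a0 a1]; rewrite /clip max_r ?min_r. Qed.

Lemma clip_lipschitz (real : realFieldType) (a b : real) :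
  (clip a - clip b) ^+ 2 <= (a - b) ^+ 2.
Proof.
wlog ab : a b / a <= b => [H|].
  by have [/H//|/ltW/H] := leP a b; rewrite -sqrrN opprB -[leRHS]sqrrN opprB.
have clipP (x : real) : [\/ x <= 0 /\ clip x = 0, [/\ 0 <= x, x <= 1 & clip x = x]
                 | 1 <= x /\ clip x = 1].
  have [x0|x0] := leP x 0; first by constructor 1; rewrite clip_le0.
  have [x1|x1] := leP 1 x; first by constructor 3; rewrite clip_ge1.
  by constructor 2; rewrite clip_id !ltW.
rewrite -sqrrN opprB -[leRHS]sqrrN opprB.
suff [h1 h2] : 0 <= clip b - clip a /\ clip b - clip a <= b - a.
  by rewrite ler_sqr// nnegrE (le_trans h1).
by case: (clipP a) => [[? ?]|[? ? ?]|[? ?]];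
  case: (clipP b) => [[? ?]|[? ? ?]|[? ?]]; split; lra.
Qed.

(** The factor of [C] is [|a|], written through the positive part of [a]; for a function of mean
    zero only that part then contributes to the mean. *)
Lemma mul_le_abs_mul (real : realFieldType) (a v C : real) : `|v| <= C ->
  a * v <= C * (2 * (a * (0 < a)%R%:R) - a).
Proof.
rewrite ler_norml => /andP[h1 h2]; have [a0|a0] := ltP 0 a.
  rewrite mulr1n (_ : C * _ = a * C); last by ring.
  by rewrite ler_wpM2l// ltW.
rewrite mulr0n (_ : C * _ = a * - C); last by ring.
by rewrite ler_wnM2l.
Qed.

Section Indicators.
Context {real : realType} {d : measure_display} {X : measurableType d}.
Variable mu : probability X real.
Implicit Types A B : set X.

(** Total in [A]: where the indicator is not measurable the default 0 is taken. *)
Definition ind A : bmf real X := insubd 0 (\1_A : X -> real).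

Lemma indE A x : measurable A -> ind A x = (x \in A)%:R.
Proof.
move=> mA; rewrite /ind /insubd insubT /= => [|_]; last by rewrite indicE.
rewrite inE; split; first exact: measurable_indic.
by exists 1 => y; rewrite indicE normr_nat lern1 leq_b1.
Qed.

Lemma mean_ind A : measurable A -> mean mu (ind A) = fine (mu A).
Proof.
move=> mA; rewrite /mean /Rintegral; congr fine.
under eq_integral do rewrite indE//.
by rewrite -[X in mu X]setIT -integral_indic.
Qed.

Lemma mean_ind_EFin A : measurable A -> (mean mu (ind A))%:E = mu A.
Proof. by move=> mA; rewrite mean_ind// fineK// fin_num_measure. Qed.

Lemma mean_ind_ge0 A : measurable A -> 0 <= mean mu (ind A).
Proof. by move=> mA; apply: mean_ge0 => x; rewrite indE. Qed.

Lemma mean_ind_le1 A : measurable A -> mean mu (ind A) <= 1.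
Proof.
move=> mA; rewrite -[leRHS](mean1 mu); apply: mean_le => x.
by rewrite indE// lern1 leq_b1.
Qed.

Lemma dist2_ind A B : measurable A -> measurable B -> A `<=` B ->
  dist2 mu (ind A) (ind B) = mean mu (ind B) - mean mu (ind A).
Proof.
move=> mA mB AB; rewrite /dist2 -linearB; congr mean; apply: bmf_ext => x.
rewrite bmfX !bmfB !indE//.
have [/set_mem/AB/mem_set -> | _] := boolP (x \in A).
  by rewrite subrr expr0n.
by rewrite sub0r sqrrN subr0; case: (x \in B); rewrite ?expr1n ?expr0n.
Qed.

Lemma ind_approx (U : nat -> set X) e : (forall n, measurable (U n)) ->
  (forall n, U n `<=` U n.+1) -> 0 < e ->
  exists n, mean mu (ind (\bigcup_k U k)) - mean mu (ind (U n)) <= e.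
Proof.
move=> mU ndU e0.
have mUU : measurable (\bigcup_k U k) by exact: bigcupT_measurable.
have ndU' : nondecreasing_seq U.
  by apply/nondecreasing_seqP => n; apply/subsetPset/ndU.
have : mu (U n) @[n --> \oo] --> (mean mu (ind (\bigcup_k U k)))%:E.
  by rewrite mean_ind_EFin//; exact: nondecreasing_cvg_mu.
move=> /fine_cvgP[_] /cvgrPdist_le/(_ _ e0)[n _ hn].
exists n; apply: le_trans (ler_norm _) _; rewrite (mean_ind (mU n)).
exact: (hn n (leqnn n)).
Qed.

End Indicators.

Section AlmostPeriodicSets.
Context {real : realType} {G : zmodType}
  {d : measure_display} {X : measurableType d} {mu : probability X real}.
Variable T : mp_system G mu.
Variable Gam : set G.

Definition ap_sets : set (set X) :=
  [set A | measurable A /\ almost_periodic T Gam (ind A)].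

Lemma ap_sets0 : ap_sets set0.
Proof.
split=> //; have -> : ind set0 = 0 *: (1 : bmf real X).
  by apply: bmf_ext => x; rewrite indE// bmfZ mul0r in_set0.
exact: almost_periodic_cst.
Qed.

Lemma ap_setsC A : ap_sets A -> ap_sets (~` A).
Proof.
move=> [mA hA]; have mC := measurableC mA; split; first exact: mC.
apply: (@almost_periodic_pointwise _ _ _ _ _ _ _ _ [:: ind A] 1).
  by move=> u; rewrite mem_seq1 => /eqP ->.
move=> x y; rewrite big_seq1 mul1r !indE// !in_setC.
by do 2 case: (_ \in A); rewrite ?subrr ?subr0 ?sub0r// sqrrN.
Qed.

Lemma ap_setsU A B : ap_sets A -> ap_sets B -> ap_sets (A `|` B).
Proof.
move=> [mA hA] [mB hB]; have mU := measurableU _ _ mA mB; split; first exact: mU.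
apply: (@almost_periodic_pointwise _ _ _ _ _ _ _ _ [:: ind A; ind B] 1).
  by move=> u; rewrite in_cons mem_seq1 => /orP[] /eqP ->.
move=> x y; rewrite big_cons big_seq1 mul1r !indE// !in_setU.
by case: (x \in A); case: (y \in A); case: (x \in B); case: (y \in B);
  rewrite /= ?mulr0n ?mulr1n; lra.
Qed.

Lemma ap_sets_bigcup (A : nat -> set X) :
  (forall n, ap_sets (A n)) -> ap_sets (\bigcup_k A k).
Proof.
move=> hA; pose U n := \big[setU/set0]_(i < n.+1) A i.
have apU' n : ap_sets (\big[setU/set0]_(i < n) A i).
  elim: n => [|n IH]; rewrite ?big_ord0; first exact: ap_sets0.
  rewrite big_ord_recr; apply: ap_setsU; [exact: IH|exact: hA].
have apU n : ap_sets (U n) by exact: apU'.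
have UE : \bigcup_k U k = \bigcup_k A k by rewrite bigcup_bigsetU_bigcup.
have mU n : measurable (U n) by case: (apU n).
have mUU : measurable (\bigcup_k U k) by exact: bigcupT_measurable.
rewrite -UE; split=> //; apply: almost_periodic_lim => e e0.
have [n hn] := ind_approx mu mU (fun n x => @subset_bigsetU _ A n.+1 n.+2 (leqnSn _) x) e0.
exists (ind (U n)); first by case: (apU n).
by rewrite dist2_ind//; exact: bigcup_sup.
Qed.

Lemma ap_sets_sigma_algebra : sub_sigma_algebra_of ap_sets.
Proof.
split; last by move=> A [].
split; [exact: ap_sets0| |exact: ap_sets_bigcup].
by move=> A; rewrite setTD; exact: ap_setsC.
Qed.

Lemma koop_ind g A : measurable A -> koop T g (ind A) = ind (T g @^-1` A).
Proof.
move=> mA; apply: bmf_ext => x; rewrite koopE !indE//.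
by rewrite -[X in measurable X]setTI; exact: mp_act_measurable.
Qed.

Lemma ap_sets_invariant : invariant_sets T ap_sets.
Proof.
move=> g A [mA hA]; split; last first.
  by rewrite -koop_ind//; exact: almost_periodic_koop.
by rewrite -[X in measurable X]setTI; exact: mp_act_measurable.
Qed.

Definition ap_nontrivial :=
  exists2 A, ap_sets A & 0 < mean mu (ind A) < 1.

(** [clip (n%:R * F x)] is Lipschitz in [F x], hence almost periodic, and lies between the
    indicators of [V n] and of [A]. As [V n] increases to [A], it tends to the indicator of [A] in
    [L^2]. *)
Lemma positive_set_ap (F : bmf real X) : almost_periodic T Gam F ->
  ap_sets [set x | 0 < F x].
Proof.
move=> hF; pose A := [set x | 0 < F x].
have mF := bmf_measurable F.
have mA : measurable A.
  have -> : A = setT `&` F @^-1` `]0, +oo[%classic.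
    by apply/seteqP; split=> x /=; rewrite in_itv /= andbT; [split|case].
  exact: mF.
pose V n := [set x | 1 <= n%:R * F x].
have mV n : measurable (V n).
  have -> : V n = setT `&` (n%:R *: F : bmf real X) @^-1` `[1, +oo[%classic.
    by apply/seteqP; split=> x /=; rewrite in_itv /= andbT; [split|case].
  exact: bmf_measurable.
have Fpos n x : V n x -> 0 < F x.
  rewrite /V /=; have [//|Fx] := ltP 0 (F x).
  by move=> /le_trans/(_ (mulr_ge0_le0 (ler0n _ n) Fx)); rewrite ler10.
have VS n : V n `<=` V n.+1.
  move=> x Vx; apply: le_trans (Vx) _; rewrite ler_wpM2r ?ler_nat//.
  exact/ltW/(Fpos n).
have VA : \bigcup_n V n = A.
  apply/seteqP; split=> [x [n _ /Fpos]//|x Ax].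
  exists (Num.truncn (F x)^-1).+1 => //=.
  by rewrite /V /= -ler_pdivrMr// div1r ltW// truncnS_gt.
split=> //; apply: almost_periodic_lim => e e0.
have [n] := ind_approx mu mV VS e0; rewrite VA => hn.
pose phi x := clip (n%:R * F x).
have phiP : phi \in @bmf_pred real d X.
  rewrite inE; split.
    apply: measurable_minr; first exact: measurable_cst.
    apply: measurable_maxr; first exact: measurable_cst.
    exact: (bmf_measurable (n%:R *: F)).
  exists 1 => x; rewrite /phi /clip ger0_norm ?ge_min ?lexx//.
  by rewrite le_min ler01 le_max lexx.
exists (Bmf phiP).
  apply: (@almost_periodic_pointwise _ _ _ _ _ _ _ _ [:: F] (n%:R ^+ 2)).
    by move=> u; rewrite mem_seq1 => /eqP ->.
  by move=> x y; rewrite big_seq1 -exprMn mulrBr; exact: clip_lipschitz.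
apply: le_trans hn; rewrite -linearB; apply: mean_le => x.
rewrite bmfX !bmfB !indE// /= /phi.
have [Fx|Fx] := ltP 0 (F x); last first.
  rewrite clip_le0 ?mulr_ge0_le0// !memNset ?subrr ?expr0n//=.
    by move=> /Fpos; rewrite ltNge Fx.
  by apply/negP; rewrite -leNgt.
rewrite (mem_set (Fx : A x)); have [Vx|Vx] := leP 1 (n%:R * F x).
  by rewrite clip_ge1// subrr expr0n subr_ge0 lern1 leq_b1.
rewrite memNset ?subr0; last by apply/negP; rewrite -ltNge.
have h : 0 <= n%:R * F x by rewrite mulr_ge0// ltW.
rewrite clip_id; last by rewrite h ltW.
rewrite -sqrrN opprB mulr1n expr_le1//; first by rewrite gerBl.
by rewrite subr_ge0 ltW.
Qed.

(** Take the set [A] where [F > 0]. Since [F] has mean zero, [mean mu (F * f)] is at most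
    [2 * C * mean mu (F * ind A)], so the latter is positive; Cauchy-Schwarz then bounds it away
    from 0 both on [A] and on its complement, which thus have positive measure. *)
Lemma ap_nontrivial_of_function (F f : bmf real X) :
  almost_periodic T Gam F -> mean mu F = 0 -> 0 < mean mu (F * f) ->
  ap_nontrivial.
Proof.
move=> hF F0 Ff; have hA := positive_set_ap hF.
set A := [set x | 0 < F x] in hA; exists A => //.
have [mA _] := hA; have [C hC] := bmf_bounded f.
have AE x : ind A x = (0 < F x)%R%:R.
  by rewrite indE//; congr (_ : bool)%:R; apply/idP/idP; rewrite inE.
have m0 : 0 < mean mu (F * ind A).
  have : mean mu (F * f) <= 2 * C * mean mu (F * ind A).
    have -> : 2 * C * mean mu (F * ind A) =
        mean mu (C *: (2 *: (F * ind A) - F)).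
      by rewrite linearZ linearB linearZ /= F0 subr0; ring.
    apply: mean_le => x; rewrite bmfZ bmfB bmfZ !bmfM AE.
    exact: mul_le_abs_mul (hC x).
  move/(lt_le_trans Ff).
  have : 0 <= mean mu (F * ind A).
    apply: mean_ge0 => x; rewrite bmfM AE.
    by have [Fx|Fx] := ltP 0 (F x); rewrite ?mulr1 ?mulr0// ltW.
  by rewrite le_eqVlt => /orP[/eqP <-|//]; rewrite mulr0 ltxx.
have F2 := mean_sqr_ge0 mu F.
have i2 : ind A ^+ 2 = ind A :> bmf real X.
  by apply: bmf_ext => x; rewrite bmfX AE; case: (0 < F x); rewrite ?expr1n ?expr0n.
apply/andP; split.
  have := mean_CS mu F (ind A); rewrite i2 => h.
  have : 0 < mean mu (F ^+ 2) * mean mu (ind A).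
    by apply: lt_le_trans h; rewrite exprn_gt0.
  by move: (mean_ind_ge0 mu mA); rewrite le_eqVlt => /orP[/eqP <-|//]; rewrite mulr0 ltxx.
rewrite -subr_gt0.
have h1 : mean mu (F * (1 - ind A)) = - mean mu (F * ind A).
  by rewrite mulrBr mulr1 linearB /= F0 sub0r.
have h2 : (1 - ind A) ^+ 2 = 1 - ind A :> bmf real X.
  by rewrite sqrrB i2 mul1r expr1n mulr2n opprD addrA subrK.
have := mean_CS mu F (1 - ind A); rewrite h2 h1 sqrrN linearB /= mean1 => h.
have : 0 < mean mu (F ^+ 2) * (1 - mean mu (ind A)).
  by apply: lt_le_trans h; rewrite exprn_gt0.
have := mean_ind_le1 mu mA; rewrite -subr_ge0 le_eqVlt => /orP[/eqP <-|//].
by rewrite mulr0 ltxx.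
Qed.

End AlmostPeriodicSets.

(** * The primitive factor and its return times *)

Lemma return_arith (real : realFieldType) (p q a s e : real) :
  - (e / 2) < p - q -> a <= q -> s < e / 2 -> a - e < p - s.
Proof. by move=> *; lra. Qed.

Section PrimitiveFactor.
Context {real : realType} {R : pzRingType} {G : lmodType R}
  {d : measure_display} {X : measurableType d} {mu : probability X real}.
Variable T : mp_system G mu.
Implicit Types Gam : set G.

Definition submodule Gam :=
  Gam 0 /\ forall a u v, Gam u -> Gam v -> Gam (a *: u + v).

Lemma submodule_scale Gam a u : submodule Gam -> Gam u -> Gam (a *: u).
Proof. by move=> [G0 lin] Gu; rewrite -[_ *: _]addr0; exact: lin. Qed.

Lemma submodule_add_line Gam g : submodule Gam ->
  submodule (set_add Gam [set t *: g | t in [set: R]]).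
Proof.
move=> [G0 lin]; split.
  by exists 0 => //; exists 0; [exists 0 => //; rewrite scale0r|rewrite addr0].
move=> a _ _ [u Gu [_ [t _ <-] <-]] [v Gv [_ [t' _ <-] <-]].
exists (a *: u + v); first exact: lin.
exists ((a * t + t') *: g); first by exists (a * t + t').
by rewrite scalerDl -scalerA scalerDr addrACA.
Qed.

(** Without a maximal element, iterating a choice of strictly larger submodules contradicts the
    chain condition. *)
Lemma noetherian_max (P : set G -> Prop) : noetherian_module G ->
  (exists2 Gam, submodule Gam & P Gam) ->
  exists Gam, [/\ submodule Gam, P Gam &
    forall Gam', submodule Gam' -> P Gam' -> Gam `<=` Gam' -> Gam' `<=` Gam].
Proof.
move=> noeth [Gam0 sub0 P0]; apply: contrapT => nomax.
have /choice[next hnext] : forall Gam, exists Gam', submodule Gam -> P Gam ->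
    [/\ submodule Gam', P Gam', Gam `<=` Gam' & ~ (Gam' `<=` Gam)].
  move=> Gam; have [[sG PG]|h] := pselect (submodule Gam /\ P Gam); last first.
    by exists Gam => sG PG; case: h.
  apply: contrapT => hn; apply: nomax; exists Gam; split => // Gam' sG' PG' le.
  by apply: contrapT => nle; apply: hn; exists Gam'.
pose M n := iter n next Gam0.
have hM n : submodule (M n) /\ P (M n).
  by elim: n => // n [sM PM]; have [] := hnext _ sM PM.
have [|n|N hN] := noeth M.
- move=> n; have [[M0 lin] _] := hM n; split; first by rewrite inE.
  by move=> a u v; rewrite !inE; exact: lin.
- by have [sM PM] := hM n; have [] := hnext _ sM PM.
- have [sM PM] := hM N; have [_ _ _] := hnext _ sM PM; apply.
  by rewrite -[next _]/(M N.+1) (hN N.+1).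
Qed.

Lemma primitive_factor : noetherian_module G ->
  ap_nontrivial T [set 0] ->
  exists Gam, [/\ submodule Gam, ap_nontrivial T Gam &
    forall g, ~ Gam g -> forall f : bmf real X, almost_periodic T Gam f ->
      mean mu f = 0 -> null (fun t : R => mean mu (koop T (t *: g) f * f))].
Proof.
move=> noeth nt0; have [|Gam [sG ntG maxG]] := noetherian_max noeth (P := ap_nontrivial T).
  exists [set 0] => //; split=> // a u v -> ->.
  by rewrite scaler0 addr0.
exists Gam; split => // g nGg f fap f0.
have [//|[F [FG Fg F0 Ff]]] := weak_mixing_dichotomy g fap f0.
case: nGg; apply: (maxG _ (submodule_add_line g sG)).
- exact: ap_nontrivial_of_function (almost_periodic_add_sets FG Fg) F0 Ff.
- move=> u Gu; exists u => //; exists 0; last by rewrite addr0.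
  by exists 0 => //; rewrite scale0r.
- exists 0; first by case: sG.
  by exists g; [exists 1 => //; rewrite scale1r|rewrite add0r].
Qed.

(** Greedy choice. The bound on the size matters in [return_cover]: fewer cosets only raise the
    power of the measure. *)
Lemma coset_representatives Gam (gs : seq G) : submodule Gam ->
  exists hs : seq G, [/\ pairwise (fun h k => `[< ~ Gam (k - h) >]) hs,
    (size hs <= size gs)%N, gs != [::] -> hs != [::] &
    forall g, g \in gs -> exists2 h, h \in hs & Gam (g - h)].
Proof.
move=> sG; elim: gs => [|g gs [hs [hs_pw hs_size hs0 hs_rep]]].
  by exists [::].
have [[h hin hg]|nh] := pselect (exists2 h, h \in hs & Gam (g - h)).
  exists hs; split => //; first by rewrite /= ltnW.
    by move=> _; case: (hs) hin.
  by move=> g'; rewrite in_cons => /orP[/eqP->|/hs_rep//]; exists h.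
exists (g :: hs); split => //=.
  rewrite hs_pw andbT; apply/allP => h hin; apply/asboolP => hg.
  apply: nh; exists h => //; rewrite -opprB -scaleN1r.
  exact: submodule_scale.
move=> g'; rewrite in_cons => /orP[/eqP->|/hs_rep[h hin hg']].
  by exists g; rewrite ?mem_head// subrr; case: sG.
by exists h => //; rewrite in_cons hin orbT.
Qed.

Variable Gam : set G.
Hypothesis sG : submodule Gam.
Hypothesis mixing : forall g, ~ Gam g -> forall f : bmf real X,
  almost_periodic T Gam f -> mean mu f = 0 ->
  null (fun t : R => mean mu (koop T (t *: g) f * f)).

(** Colour [t] by the colours of all [t *: g]. If [k] represents the class of [t], translating back
    by [k *: g] makes [t - k] a time of almost return. *)
Lemma almost_return (f : bmf real X) (gs : seq G) e : 0 < e ->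
  almost_periodic T Gam f -> (forall g, g \in gs -> Gam g) ->
  finite_cover [set t : R | forall g, g \in gs ->
    dist2 mu (koop T (t *: g) f) f <= e].
Proof.
move=> e0 fap hgs.
have H g : g \in gs -> finitely_coloured (fun v w : R =>
    dist2 mu (koop T (v *: g) f) (koop T (w *: g) f) <= e).
  move=> /hgs Gg; have := finitely_coloured_comp (fun t : R => t *: g) (fap _ e0).
  by apply: finitely_coloured_sub => v w; apply; exact: submodule_scale.
have [ks hks] := finitely_coloured_reps (finitely_coloured_all H).
exists [seq - k | k <- ks] => t; have [k kin hk] := hks t.
exists (- k); first exact: map_f.
move=> g gin; rewrite -(dist2_koop T (k *: g)) koop_add -scalerDl.
by rewrite addrC subrK; exact: hk.
Qed.

(** If some [a i] fails while [b] holds, then [c i] holds and the [i]-th square is 1, which absorbs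
    the left side. *)
Lemma zero_one_product (I : eqType) (J : seq I) (a : I -> bool) (b : bool)
    (c : I -> bool) :
  (forall i, i \in J -> b -> c i) ->
  (b%:R : real) - \sum_(i <- J) ((c i)%:R - (a i)%:R) ^+ 2 <=
    \prod_(i <- J) (a i)%:R.
Proof.
move=> bc; have [/allP ha|] := boolP (all a J).
  rewrite [leRHS]big_seq [leRHS]big1; last by move=> i iJ; rewrite (ha i iJ).
  rewrite lerBlDr ler_wpDr ?lern1 ?leq_b1//.
  by apply: sumr_ge0 => i _; exact: sqr_ge0.
move=> /allPn[i iJ /negbTE ai].
apply: (@le_trans _ _ 0); last by apply: prodr_ge0.
rewrite subr_le0; case: b bc => [bc|_]; last first.
  by apply: sumr_ge0 => j _; exact: sqr_ge0.
rewrite (big_rem i)//= (bc i iJ isT) ai subr0 expr1n lerDl.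
by apply: sumr_ge0 => j _; exact: sqr_ge0.
Qed.

(** Each [g i] is replaced by its coset representative, at a cost controlled by [almost_return]. The
    representatives are distinct modulo [Gam]; after translation by one of them, [h0], the elements
    [h - h0] satisfy the hypotheses of [multiple_mixing]. *)
Lemma return_cover (A : set X) (l : nat) (g : 'I_l -> G) (e : real) :
  ap_sets T Gam A -> (0 < l)%N -> 0 < e ->
  finite_cover [set t : R | mean mu (ind A) ^+ l - e <
    mean mu (\prod_(i < l) koop T (t *: g i) (ind A))].
Proof.
move=> [mA hA] l0 e0.
have [hs [hs_pw hs_size hs0 hs_rep]] := coset_representatives (codom g) sG.
have {}hs0 : hs != [::].
  by apply: hs0; rewrite -size_eq0 size_codom card_ord -lt0n.
rewrite size_codom card_ord in hs_size.
have /choice[c hc] : forall i, exists h, h \in hs /\ Gam (g i - h).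
  by move=> i; have [h] := hs_rep _ (codom_f g i); exists h.
case: hs hs0 hs_pw hs_size {hs_rep} hc => // h0 hs _ /andP[/allP h0hs hs_pw] hs_size hc.
pose s := [seq (h - h0, ind A) | h <- hs] : seq (G * bmf real X).
have mix : null (fun t : R => mean mu (ind A * \prod_(p <- s) koop T (t *: p.1) p.2) -
              mean mu (ind A) * \prod_(p <- s) mean mu p.2).
  apply: (multiple_mixing mixing).
  - by move=> _ /mapP[h hin ->] /=; apply/asboolP; exact: h0hs.
  - rewrite pairwise_map; apply: sub_pairwise hs_pw => p q /asboolP hpq.
    by apply/asboolP => /=; rewrite opprB addrA subrK.
  - by move=> _ /mapP[h hin ->].
(* [l] errors of this size add up to strictly less than [e / 2]. *)
have dl0 : 0 < e / 2 / (l.+1)%:R by rewrite !divr_gt0.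
have ret := @almost_return (ind A) (codom (fun i => g i - c i)) _ dl0 hA.
have {}ret : finite_cover [set t : R | forall h, h \in codom (fun i => g i - c i) ->
    dist2 mu (koop T (t *: h) (ind A)) (ind A) <= e / 2 / (l.+1)%:R].
  by apply: ret => _ /codomP[i ->]; case: (hc i).
have e2 : 0 < e / 2 by rewrite divr_gt0.
apply: finite_cover_sub (finite_cover_null e2 ret mix) => t [/= hret hmix].
have alpha1 := mean_ind_le1 mu mA; have alpha0 := mean_ind_ge0 mu mA.
have key : mean mu (\prod_(h <- h0 :: hs) koop T (t *: h) (ind A)) -
    \sum_(i < l) dist2 mu (koop T (t *: c i) (ind A)) (koop T (t *: g i) (ind A))
    <= mean mu (\prod_(i < l) koop T (t *: g i) (ind A)).
  rewrite /dist2 -linear_sum -linearB; apply: mean_le => x.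
  rewrite bmfB bmf_sum !bmf_prod.
  under eq_bigr do rewrite koopE indE//.
  under [X in _ - X]eq_bigr do rewrite bmfX bmfB !koopE !indE//.
  under [X in _ <= X]eq_bigr do rewrite koopE indE//.
  have -> : \prod_(h <- h0 :: hs) (T (t *: h) x \in A)%:R =
      (all (fun h => T (t *: h) x \in A) (h0 :: hs))%:R :> real.
    elim: (h0 :: hs) => [|h k IH]; first by rewrite big_nil.
    by rewrite big_cons IH /= -natrM mulnb.
  apply: (@zero_one_product _ (index_enum _) (fun i => T (t *: g i) x \in A) _
    (fun i => T (t *: c i) x \in A)).
  by move=> i _ /allP; apply; case: (hc i).
apply: lt_le_trans key.
have sumle : \sum_(i < l) dist2 mu (koop T (t *: c i) (ind A)) (koop T (t *: g i) (ind A))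
   < e / 2.
  apply: (@le_lt_trans _ _ (\sum_(i < l) (e / 2 / (l.+1)%:R))).
    apply: ler_sum => i _; rewrite dist2C -(subrK (c i) (g i)) scalerDr addrC.
    rewrite -koop_add dist2_koop; apply: hret; exact: codom_f.
  rewrite big_const_ord iter_addr_0 -[_ *+ l]mulr_natr -mulrA gtr_pMr//.
  by rewrite mulrC ltr_pdivrMr// mul1r ltr_nat.
have prodE : mean mu (\prod_(h <- h0 :: hs) koop T (t *: h) (ind A)) =
    mean mu (ind A * \prod_(p <- s) koop T (t *: p.1) p.2).
  rewrite -[RHS](mean_koop T (t *: h0)) rmorphM /= rmorph_prod /= big_cons.
  congr (mean mu (_ * _)); rewrite /s big_map; apply: eq_bigr => h _ /=.
  by rewrite koop_add -scalerDr addrC subrK.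
have powE : mean mu (ind A) * \prod_(p <- s) mean mu p.2 =
    mean mu (ind A) ^+ (size hs).+1.
  rewrite /s big_map /= big_const_seq count_predT exprS; congr (_ * _).
  by elim: (size hs) => //= n ->; rewrite exprS.
have powle : mean mu (ind A) ^+ l <= mean mu (ind A) ^+ (size hs).+1.
  by apply: ler_wiXn2l.
rewrite prodE; rewrite powE in hmix.
by move: hmix; rewrite ltr_norml => /andP[hmix _]; exact: return_arith hmix powle sumle.
Qed.

End PrimitiveFactor.

(** * Syndetic sets and lower Banach density *)

Lemma half_le_of_sum (real : realFieldType) (a b : real) :
  b <= 2^-1 -> 1 <= a + b -> 2^-1 <= a.
Proof. by move=> *; lra. Qed.

Section BorelSets.
Variable V : topologicalZmodType.

Lemma borel_open (U : set V) : open U -> measurable (U : set (Borel V)).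
Proof. by move=> oU; exact: sub_gen_smallest. Qed.

Lemma borel_compact (K : set V) : hausdorff_space V -> compact K ->
  measurable (K : set (Borel V)).
Proof.
move=> hV cK; rewrite -[K]setCK; apply: measurableC; apply: borel_open.
by rewrite openC; exact: compact_closed.
Qed.

Lemma borel_continuous (W : topologicalZmodType) (f : V -> W) :
  continuous f -> measurable_fun setT (f : Borel V -> Borel W).
Proof.
move=> cf; apply: (@measurability _ _ (Borel V) (Borel W) setT f (@open W)) => //.
move=> _ [U oU <-]; rewrite setTI; apply: borel_open.
by move/continuousP : cf; exact.
Qed.

Lemma translation_continuous (v : V) : continuous (fun a : V => v + a).
Proof.
move=> a; apply: (@continuous_comp _ _ _ (fun a : V => (v, a)) (fun z => z.1 + z.2)).
  by apply: cvg_pair; [exact: cvg_cst|exact: cvg_id].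
exact: add_continuous.
Qed.

Lemma borel_translate (v : V) (B : set (Borel V)) : measurable B ->
  measurable ([set v + a | a in B] : set (Borel V)).
Proof.
move=> mB; have -> : [set v + a | a in B] = (fun a : V => - v + a) @^-1` B.
  apply/seteqP; split=> [_ [a Ba <-]|a Ba] /=; first by rewrite addKr.
  by exists (- v + a) => //; rewrite addrA subrr add0r.
have := borel_continuous (@translation_continuous (- v)) measurableT mB.
by rewrite setTI.
Qed.

Lemma syndetic_of_finite_cover (N : set V) : finite_cover N -> syndetic_set N.
Proof.
move=> [ks hks]; exists [set` [seq - k | k <- ks]].
  exact/finite_compact/finite_seq.
apply/seteqP; split=> // t _; have [k kin Nk] := hks t.
exists (- k); first by rewrite /= map_f.
by exists (t + k) => //; rewrite addrC addrK.
Qed.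

Lemma measure_cover (real : realType) (I : eqType) (ks : seq I)
    (m : {measure set (Borel V) -> \bar real}) (F : set (Borel V))
    (P : I -> set (Borel V)) :
  measurable F -> (forall k, measurable (P k)) ->
  (forall t, F t -> exists2 k, k \in ks & P k t) ->
  (m F <= \sum_(k <- ks) m (F `&` P k))%E.
Proof.
move=> mF mP; elim: ks F mF => [|k ks IH] F mF hF.
  rewrite big_nil (_ : F = set0) ?measure0//.
  by apply/seteqP; split => // t /hF[].
rewrite big_cons; have mFk : measurable (F `&` P k) by exact: measurableI.
have mFk' : measurable (F `\` P k) by exact: measurableD.
rewrite (measureDI m mF (mP k)) addeC.
apply: leeD => //; apply: le_trans (IH _ mFk' _) _.
  by move=> t [/hF[j]]; rewrite in_cons => /orP[/eqP->//|jks Pj _]; exists j.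
apply: lee_sum => j _; apply: le_measure; rewrite ?inE.
- exact: measurableI.
- exact: measurableI.
- by move=> t [[? _] ?].
Qed.

(** The sets [Nt k] cover [F n]. Translation by [k] sends the part of [F n] in [Nt k] into [F n]
    intersected with [N], up to the symmetric difference of [F n] and its translate. So 1 is at most
    [size ks] times the density plus an error tending to 0; once the error is below 1/2, the density
    is at least [2^-1 / size ks]. *)
Lemma lower_density_of_finite_cover (real : realType)
    (m : {measure set (Borel V) -> \bar real}) (N : set V) :
  hausdorff_space V -> is_haar m -> measurable (N : set (Borel V)) ->
  finite_cover N -> positive_lower_Banach_density m N.
Proof.
move=> hV [minv mcpt _] mN [ks hks] F [Fcpt Fpos Ffol].
have mF n : measurable (F n : set (Borel V)) by exact: borel_compact.
have tcpt n v : compact [set v + a | a in F n].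
  apply: continuous_compact (Fcpt n).
  exact/continuous_subspaceT/translation_continuous.
have mtF n v : measurable ([set v + a | a in F n] : set (Borel V)).
  exact: borel_compact.
pose Nt v := [set t | N (v + t)] : set (Borel V).
have mNt v : measurable (Nt v).
  have := borel_continuous (@translation_continuous v) measurableT mN.
  by rewrite setTI.
pose S v n := [set v + a | a in F n] `+` F n : set (Borel V).
have mS n v : measurable (S v n).
  by apply: measurableU; exact: measurableD.
have fin (A : set (Borel V)) (B : set V) : measurable A -> compact B -> A `<=` B ->
    m A \is a fin_num.
  move=> mA cB AB; rewrite ge0_fin_numE//; apply: le_lt_trans (mcpt _ cB).
  by apply: le_measure; rewrite ?inE//; exact: borel_compact.
have finF n : m (F n) \is a fin_num by exact: fin (Fcpt n) _.
have finFN n : m (F n `&` N) \is a fin_num.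
  by apply: fin (Fcpt n) _; [exact: measurableI|exact: subIsetl].
have finS n v : m (S v n) \is a fin_num.
  apply: fin (compactU (tcpt n v) (Fcpt n)) _ => // t [[? _]|[? _]].
    by left.
  by right.
pose a n := fine (m (F n)).
have a0 n : 0 < a n by rewrite fine_gt0// Fpos -ge0_fin_numE//=.
pose r n := fine (m (F n `&` N)) / a n.
pose dl v n := fine (m (S v n)) / a n.
have step n v : (m (F n `&` Nt v) <=
    m (F n `&` N) + m (S v n))%E.
  have mI : measurable ((F n : set (Borel V)) `&` Nt v) by exact: measurableI.
  have mFN : measurable (F n `&` N : set (Borel V)) by exact: measurableI.
  rewrite -(minv v _ mI).
  have sub : [set v + t | t in F n `&` Nt v] `<=`
      (F n `&` N) `|` S v n.
    move=> _ [t [Ft Ntt] <-]; have [Fvt|nFvt] := pselect (F n (v + t)).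
      by left.
    by right; left; split => //; exists t.
  apply: le_trans (measureU2 _ mFN (mS n v)).
  apply: le_measure; rewrite ?inE; last exact: sub.
    exact: borel_translate.
  exact: measurableU.
have main n : 1 <= (size ks)%:R * r n + \sum_(k <- ks) dl k n.
  have := measure_cover (I := V) (ks := ks) m (mF n) mNt.
  have cov t : F n t -> exists2 k, k \in ks & Nt k t.
    by move=> _; have [k kin Nk] := hks t; exists k => //; rewrite /Nt /= addrC.
  move=> /(_ cov) h.
  have := le_trans h (lee_sum _ (fun k _ => step n k)).
  rewrite -(fineK (finF n)) -(fineK (finFN n)).
  under eq_bigr do rewrite -(fineK (finS n _)) -EFinD.
  rewrite sumEFin lee_fin big_split /= big_const_seq count_predT iter_addr_0.
  rewrite -(@ler_pM2r _ (a n)^-1) ?invr_gt0//.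
  have an0 : a n != 0 by rewrite gt_eqF.
  rewrite -[fine (m (F n))]/(a n) divff// mulrDl.
  by rewrite mulr_suml -[_ *+ size ks]mulr_natl -mulrA.
have p0 : 0 < (size ks)%:R :> real.
  by rewrite ltr0n; have [k] := hks 0; case: (ks).
have dl_cvg : \sum_(k <- ks) dl k n @[n --> \oo] --> (0 : real).
  elim: ks {hks main p0} => [|k ks IH].
    by under eq_fun do rewrite big_nil; exact: cvg_cst.
  under eq_fun do rewrite big_cons.
  have h : dl k n @[n --> \oo] --> (0 : real) by exact: Ffol.
  have := cvgD h IH; rewrite addr0 => h'; exact: h'.
have half0 : 0 < 2^-1 :> real by rewrite invr_gt0.
have rge : \forall n \near \oo, 2^-1 / (size ks)%:R <= r n.
  move/cvgrPdist_le : dl_cvg => /(_ _ half0); apply: filterS => n.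
  rewrite sub0r normrN => /(le_trans (ler_norm _)) h.
  rewrite ler_pdivrMr// mulrC; have := main n.
  exact: half_le_of_sum.
apply: (@lt_le_trans _ _ (2^-1 / (size ks)%:R)%:E).
  by rewrite lte_fin divr_gt0.
have [n0 _ hn0] := rge.
rewrite limn_einf_lim; apply: lime_ge; first exact: is_cvg_einfs.
exists n0 => // n /= n0n; apply: le_ereal_inf_tmp => _ [j /= nj <-].
by rewrite lee_fin; apply: hn0; exact: leq_trans nj.
Qed.

End BorelSets.

(** * Recurrence *)

Section Recurrence.
Context {real : realType} {R : addTopRingType} {G : addTopLmodType R}
  {d : measure_display} {X : measurableType d} {mu : probability X real}
  {act : G -> X -> X}.
Hypothesis hX : standard_borel_space mu act.

(** Closed transparently, so that the action of this system reduces to [act]. *)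
Definition sbs_system : mp_system G mu.
Proof.
refine (@MpSystem real G d X mu act (sbs_act0 hX) (sbs_actD hX) _
  (sbs_preserving hX)).
move=> g; have := sbs_measurable hX.
by move=> /measurableT_comp/(_ (pair1_measurable (g : Borel G))).
Defined.

Let T := sbs_system.

(** The integrand is jointly measurable in time and space, by continuity of the scaling and joint
    measurability of the action; Tonelli makes its integral measurable in time. *)
Lemma return_times_measurable (l : nat) (g : 'I_l -> G) (A : set X) (e : real) :
  continuous (fun z : R * G => z.1 *: z.2) -> measurable A ->
  measurable (return_times mu act g A e : set (Borel R)).
Proof.
move=> cts mA.
pose f (p : Borel R * X) : \bar real :=
  (\prod_(i < l) translate act ((p.1 : R) *: g i) (\1_A : X -> real) p.2)%:E.
have mf : measurable_fun setT f.
  apply/measurable_EFinP; apply: measurable_prod => i _.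
  apply: (@measurableT_comp _ _ _ _ _ _ (\1_A : X -> real) _
    (fun p : Borel R * X => act ((p.1 : R) *: g i) p.2)).
    exact: measurable_indic.
  apply: (measurableT_comp (sbs_measurable hX)
    (g := fun p : Borel R * X => (((p.1 : R) *: g i : Borel G), p.2))).
  apply: measurable_fun_pair; last exact: measurable_snd.
  apply: (@measurableT_comp _ _ _ _ _ _
    (fun t : Borel R => ((t : R) *: g i : Borel G)) _ fst); last exact: measurable_fst.
  apply: borel_continuous => t.
  apply: (@continuous_comp _ _ _ (fun t : R => (t, g i)) (fun z => z.1 *: z.2)).
    by apply: cvg_pair; [exact: cvg_id|exact: cvg_cst].
  exact: cts.
have f0 p : (0 <= f p)%E.
  by rewrite lee_fin prodr_ge0// => i _; rewrite /translate indicE.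
have mF := @measurable_fun_fubini_tonelli_F _ _ (Borel R) X real mu f mf f0.
have -> : return_times mu act g A e =
  setT `&` fubini_F mu f @^-1` `](mu A ^+ l - e%:E)%E, +oo[%classic.
  by rewrite setTI preimage_itvoy.
by apply: mF => //; exact: emeasurable_itv.
Qed.

Lemma finite_cover_return_times (l : nat) (g : 'I_l -> G) (A : set X) (e : real) :
  measurable A ->
  finite_cover [set t : R | mean mu (ind A) ^+ l - e <
    mean mu (\prod_(i < l) koop T (t *: g i) (ind A))] ->
  finite_cover (return_times mu act g A e).
Proof.
move=> mA; apply: finite_cover_sub => t /=; rewrite /return_times /=.
rewrite -mean_ind_EFin// -EFin_expe -EFinB => h.
suff -> : (\int[mu]_x (\prod_(i < l)
    translate act (t *: g i) (\1_A : X -> real) x)%:E)%E =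
  (mean mu (\prod_(i < l) koop T (t *: g i) (ind A)))%:E by rewrite lte_fin.
rewrite /mean /Rintegral fineK; last first.
  exact: (integrable_fin_num measurableT (bmf_integrable mu _)).
apply: eq_integral => x _; rewrite bmf_prod; congr EFin.
by apply: eq_bigr => i _; rewrite koopE indE// /translate indicE.
Qed.

Lemma nontrivial_ap_nontrivial : ~ trivial_mod0 mu measurable ->
  ap_nontrivial T [set 0].
Proof.
move=> ntriv; apply: contrapT => nap; apply: ntriv; split; last first.
  by move=> A [->|->]; [exists set0|exists setT] => //; rewrite setYK measure0.
move=> A mA; have [h|h] := pselect (0 < mean mu (ind A) < 1).
  (* Under the zero submodule orbits are single points, so one colour suffices. *)
  case: nap; exists A => //; split=> // e e0; exists unit, (fun=> tt) => v w _ -> ->.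
  by rewrite /dist2 subrr expr0n /= linear0 ltW.
move: h; rewrite lt_neqAle mean_ind_ge0// andbT lt_neqAle mean_ind_le1// andbT.
move/negP; rewrite negb_and !negbK => /orP[/eqP A0|/eqP A1].
  exists set0; first by left.
  by rewrite setY0; apply: etrans (esym (mean_ind_EFin mu mA)) _; rewrite -A0.
exists setT; first by right.
rewrite setYTC; apply: etrans (probability_setC mu mA) _.
by rewrite -mean_ind_EFin// A1 subee.
Qed.

Lemma ap_nontrivial_not_trivial (Gam : set G) : ap_nontrivial T Gam ->
  ~ trivial_mod0 mu (ap_sets T Gam).
Proof.
move=> [A hA /andP[A0 A1]] [/(_ A hA)[B [->|->]] + _]; have [mA _] := hA.
  rewrite setY0 => /(etrans (mean_ind_EFin mu mA))[A0'].
  by rewrite A0' ltxx in A0.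
rewrite setYTC => /(etrans (esym (probability_setC mu mA))).
rewrite -mean_ind_EFin// -EFinB => -[].
by move/eqP; rewrite subr_eq0 => /eqP A1'; rewrite -A1' ltxx in A1.
Qed.

End Recurrence.

Theorem theorem0p1
    (real : realType) (R : addTopRingType) (G : addTopLmodType R)
    (hG : lcscN_module G)
    (m : {measure set (Borel R) -> \bar real}) (hm : is_haar m)
    (d : measure_display) (X : measurableType d) (mu : probability X real)
    (act : G -> X -> X) (hX : standard_borel_space mu act)
    (hnontriv : ~ trivial_mod0 mu measurable) :
  exists X1 : set (set X),
    [/\ sub_sigma_algebra_of X1,
        invariant_sets act X1,
        ~ trivial_mod0 mu X1 &
        forall A : set X, X1 A -> (0 < mu A)%E ->
        forall (l : nat) (g : 'I_l -> G) (eps : real),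
          (2 <= l)%N -> 0 < eps ->
          positive_lower_Banach_density m (return_times mu act g A eps) /\
          syndetic_set (return_times mu act g A eps)].
Proof.
have nt0 := nontrivial_ap_nontrivial hX hnontriv.
have [Gam [sG ntG mixing]] := primitive_factor (lcscN_noetherian hG) nt0.
exists (ap_sets (sbs_system hX) Gam); split.
- exact: ap_sets_sigma_algebra.
- exact: (@ap_sets_invariant _ _ _ _ _ (sbs_system hX)).
- exact: ap_nontrivial_not_trivial.
- move=> A hA _ l g eps l2 eps0; have [mA _] := hA.
  have cover : finite_cover (return_times mu act g A eps).
    apply: (finite_cover_return_times mA).
    exact: (return_cover sG mixing g hA (ltnW l2) eps0).
  split; last exact: syndetic_of_finite_cover.
  apply: lower_density_of_finite_cover => //.
    by have [_ _] := lcscN_ring_lcsc hG.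
  exact: (return_times_measurable hX g eps (lcscN_scale_continuous hG) mA).
Qed.
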